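(* Let $p,q\ge 1$ be integers, $\pi_1,\dots,\pi_{p-1}\in\mathbb{R}$, let $g:\mathbb{R}\to\mathbb{R}$, and let $y_t$ be generated by $$y_t=\pi_1y_{t-1}+\cdots+\pi_{p-1}y_{t-p+1}+g(u_{t-1})+\sigma_t\varepsilon_t,\qquad t=1,2,\dots,$$ $$u_t=y_t-\pi_1y_{t-1}-\cdots-\pi_{p-1}y_{t-p+1},\qquad e_t=u_t-g(u_{t-1}),$$ $$\sigma_t^2=\zeta_0(\boldsymbol{y}_{t-1})\,\omega+\alpha_1\zeta_1(\boldsymbol{y}_{t-1})e_{t-1}^2+\cdots+\alpha_q\zeta_q(\boldsymbol{y}_{t-1})e_{t-q}^2,\qquad \sigma_t>0,$$ where $\boldsymbol{y}_t=(y_t,y_{t-1},\dots,y_{t-p-q+1})$, which is a Markov chain on $\mathbb{R}^{p+q}$ with initial value $\boldsymbol{y}_0$. Suppose the following. (1) $\{\varepsilon_t,\ t=1,2,\dots\}$ are IID random variables, independent of $\boldsymbol{y}_0=(y_0,\dots,y_{1-p-q})$, with zero mean and unit variance, and the distribution of $\varepsilon_1$ has a Lebesgue density that is bounded away from zero on compact subsets of $\mathbb{R}$. (2) (i) The roots of $\varpi(z)=1-\pi_1z-\cdots-\pi_{p-1}z^{p-1}$ lie outside the unit circle (no condition if $p=1$). (ii) $g$ is measurable, locally bounded, satisfies $|g(u)|\to\infty$ as $|u|\to\infty$, and there are constants $r,M_0,K_0>0$ and $0<\rho<2$ such that $|g(u)|\le(1-r|u|^{-\rho})|u|$ for $|u|\ge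 M_0$ and $|g(u)|\le K_0$ for $|u|\le M_0$. (3) $\omega>0$, $\alpha_1,\dots,\alpha_q\ge0$, $\sum_{i=1}^q\alpha_i<1$, and each $\zeta_i:\mathbb{R}^{p+q}\to(0,1]$ ($i=0,\dots,q$) is measurable. (4) $s_0\ge1$ and $b\ge 1$ are constants such that $b=1$ if $s_0=1$, and $b>(2s_0-\rho)/[s_0(2-\rho)]$ if $s_0>1$; and there exists a monotone vector norm $\|\cdot\|_\bullet$ on $\mathbb{R}^q$ such that $$\max_{\boldsymbol{x}\in\mathbb{R}^q,\ \|\boldsymbol{x}\|_\bullet=1}\bigl(E[\|\Lambda_t\boldsymbol{x}\|_\bullet^{bs_0}]\bigr)^{1/(bs_0)}<1 ,$$ with $\Lambda_t$ the random matrix defined in the context (this entails $E|\varepsilon_1|^{2bs_0}<\infty$). Then the stationary distribution $\pi$ of the Markov chain $\boldsymbol{y}_t$ has finite moments up to order $2s_0-\rho$; that is, $\int_{\mathbb{R}^{p+q}}|x_i|^{2s_0-\rho}\,\pi(d\boldsymbol{x})<\infty$ for $i=1,\dots,p+q$ (equivalently, the stationary version of the process satisfies $E[|y_t|^{2s_0-\rho}]<\infty$).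
   Context: $\Lambda_t$ is the $q\times q$ random matrix whose first row is $(\alpha_1\varepsilon_t^2,\dots,\alpha_q\varepsilon_t^2)$, whose entries $(i+1,i)$, $i=1,\dots,q-1$, equal $1$, and whose other entries are $0$. A vector norm $\|\cdot\|$ on $\mathbb{R}^q$ is monotone if $|x_i|\le|y_i|$ for all $i=1,\dots,q$ implies $\|\boldsymbol{x}\|\le\|\boldsymbol{y}\|$. When $p=1$ there are no $\pi_i$'s and $u_t=y_t$. Under the stated hypotheses the chain $\boldsymbol{y}_t$ is ergodic, with stationary probability measure $\pi$ on $\mathbb{R}^{p+q}$.
   Formalization: When all α_i are 0, condition (4) does not entail E|ε_1|^{2bs_0}<∞ and the claim can fail, so this moment is assumed explicitly in that case; when some α_i is nonzero it is derived from (4). *)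

(* Defs.v *)
From HB Require Import structures.
From mathcomp Require Import all_boot all_order all_algebra.
From mathcomp Require Import all_classical all_reals all_analysis.
From mathcomp Require Import complex.

Set Implicit Arguments.
Unset Strict Implicit.
Unset Printing Implicit Defensive.

Import Order.TTheory GRing.Theory Num.Theory.
Import numFieldNormedType.Exports.

Local Open Scope classical_set_scope.
Local Open Scope ring_scope.

Section model.
Context {R : realType} (p q : nat).

(* [ar k] is the coefficient $\pi_{k+1}$, [alpha i] is $\alpha_{i+1}$, and
   [zeta ord0], [zeta (lift ord0 i)] are $\zeta_0$, $\zeta_{i+1}$. *)
Variables (ar : 'I_p.-1 -> R) (g : R -> R) (omega : R) (alpha : 'I_q -> R)
  (zeta : 'I_q.+1 -> (p + q).-tuple R -> R).

Definition ar_poly : {poly R} :=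
  1 - \sum_(k < p.-1) ar k *: 'X^(k.+1).

Definition u_ (y : int -> R) (t : int) : R :=
  y t - \sum_(k < p.-1) ar k * y (t - k.+1%:Z).

Definition e_ (y : int -> R) (t : int) : R := u_ y t - g (u_ y (t - 1)).

Definition state (y : int -> R) (t : int) : (p + q).-tuple R :=
  [tuple y (t - i%:Z) | i < p + q].

Definition sigma2 (y : int -> R) (t : int) : R :=
  zeta ord0 (state y (t - 1)) * omega +
  \sum_(i < q) alpha i * zeta (lift ord0 i) (state y (t - 1)) *
    e_ y (t - i.+1%:Z) ^+ 2.

(* The right-hand side of the equation for $y_t$, with innovation [z]; it only
   involves the values of [y] at times $t-1, \dots, t-p-q$. *)
Definition rhs (y : int -> R) (t : int) (z : R) : R :=
  \sum_(k < p.-1) ar k * y (t - k.+1%:Z) + g (u_ y (t - 1)) +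
  Num.sqrt (sigma2 y t) * z.

(* A path whose state at time 0 is [x]: its value at $-j$ is the coordinate
   $x_j$.  Its values at other times are irrelevant. *)
Definition path_of (x : (p + q).-tuple R) (t : int) : R := nth 0 x `|t|%N.

(* The state that follows [x] when the innovation is [z]. *)
Definition next_state (x : (p + q).-tuple R) (z : R) : (p + q).-tuple R :=
  [tuple nth 0 (rhs (path_of x) 1 z :: x) i | i < p + q].

Lemma state_path_of x : state (path_of x) 0 = x.
Proof.
apply: eq_from_tnth => i; rewrite tnth_mktuple /path_of sub0r abszN absz_nat.
by rewrite -tnth_nth.
Qed.

Lemma u_path_of y (t : int) j : (j <= q)%N -> (0 < p)%N ->
  u_ (path_of (state y t)) (- j%:Z) = u_ y (t - j%:Z).
Proof.
move=> jq p0.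
have E m : (m < p + q)%N ->
    path_of (state y t) (- m%:Z) = y (t - m%:Z).
  move=> mpq; rewrite /path_of abszN absz_nat.
  by rewrite -(tnth_nth 0 (state y t) (Ordinal mpq)) tnth_mktuple.
rewrite /u_ E; last by rewrite -{1}(add0n j) -addSn leq_add.
congr (_ - _); apply: eq_bigr => k _; congr (_ * _).
rewrite -!addrA -opprD -PoszD E ?opprD ?PoszD //.
rewrite addnC -addSn; apply: leq_add => //.
by case: (p) p0 k => //= n _ k; rewrite ltnS ltn_ord.
Qed.

(* A solution of the recursion moves from state to state by [next_state]. *)
Lemma state_next y (t : int) z : (0 < p)%N -> (0 < q)%N ->
  y (t + 1) = rhs y (t + 1) z ->
  state y (t + 1) = next_state (state y t) z.
Proof.
move=> p0 q0 yt; apply: eq_from_tnth => i; rewrite !tnth_mktuple.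
have E m : (m < p + q)%N -> nth 0 (state y t) m = y (t - m%:Z).
  by move=> mpq; rewrite -(tnth_nth 0 (state y t) (Ordinal mpq)) tnth_mktuple.
case: i => -[|m] /= mpq; last first.
  by rewrite E 1?ltnW // -addn1 PoszD opprD addrACA [1 - 1]subrr addr0.
rewrite subr0 yt /rhs /sigma2 /e_.
have S1 j : (1 - j.+1%:Z) = - j%:Z :> int by rewrite -addn1 PoszD opprD addrCA subrr addr0.
have S2 j : (t + 1 - j.+1%:Z) = t - j%:Z by rewrite -addrA S1.
have S3 j : - j%:Z - 1 = - j.+1%:Z by rewrite -addn1 PoszD opprD.
have S4 j : t - j%:Z - 1 = t - j.+1%:Z by rewrite -addrA S3.
have S5 : (1 - 1 : int) = - 0%:Z by rewrite subrr.
have S6 : t + 1 - 1 = t - 0%:Z by rewrite addrK subr0.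
rewrite S6 S5 u_path_of // subr0 [- 0]oppr0 state_path_of.
congr (_ + _ + Num.sqrt (_ + _) * _).
  apply: eq_bigr => k _; rewrite S1 S2 /path_of abszN absz_nat E //.
  rewrite (leq_trans _ (leq_addr _ _)) //.
  by rewrite (leq_trans (ltn_ord k)) // leq_pred.
apply: eq_bigr => k _; rewrite S1 S2 S3 S4 !u_path_of //; exact: ltnW.
Qed.

End model.

Section probability.
Context d (T : measurableType d) {R : realType} (P : probability T R).

Definition identically_distributed (X : nat -> T -> R) :=
  forall n (A : set R), measurable A -> P (X n @^-1` A) = P (X 0%N @^-1` A).

Definition mutually_independent (X : nat -> T -> R) :=
  forall (J : seq nat) (A : nat -> set R), uniq J ->
    (forall n, measurable (A n)) ->
    P (\bigcap_(n in [set` J]) (X n @^-1` A n)) =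
      (\prod_(n <- J) P (X n @^-1` A n))%E.

(* The sigma-algebra generated by the sequence [X]. *)
Definition sigma_seq (X : nat -> T -> R) : set (set T) :=
  <<s [set E | exists n, exists2 A : set R, measurable A & E = X n @^-1` A] >>.

Definition independent_of_seq d' (S : measurableType d') (Y : T -> S)
    (X : nat -> T -> R) :=
  forall (B : set S) (E : set T), measurable B -> sigma_seq X E ->
    P (Y @^-1` B `&` E) = (P (Y @^-1` B) * P E)%E.

(* [f] is a density of [X] with respect to Lebesgue measure. *)
Definition is_density (X : T -> R) (f : R -> R) :=
  [/\ measurable_fun setT f, (forall x, 0 <= f x) &
      forall A : set R, measurable A ->
        P (X @^-1` A) = (\int[lebesgue_measure]_(x in A) (f x)%:E)%E].

End probability.

Definition bounded_away_on_compacts {R : realType} (f : R -> R) :=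
  forall K : set R, compact K ->
    exists2 c : R, 0 < c & forall x, K x -> c <= f x.

Definition locally_bounded {R : realType} (f : R -> R) :=
  forall x : R, bounded_near f (nbhs x).

Definition is_norm {R : realType} n (N : 'cV[R]_n -> R) :=
  [/\ forall x, N x = 0 -> x = 0,
      forall a x, N (a *: x) = `|a| * N x &
      forall x y, N (x + y) <= N x + N y].

Definition monotone_norm {R : realType} n (N : 'cV[R]_n -> R) :=
  is_norm N /\
  forall x y : 'cV[R]_n, (forall i, `|x i 0| <= `|y i 0|) -> N x <= N y.

(* $\Lambda_t$ as a function of the value [z] of $\varepsilon_t$. *)
Definition Lambda {R : realType} q (alpha : 'I_q -> R) (z : R) : 'M[R]_q :=
  \matrix_(i, j) if i == 0 :> nat then alpha j * z ^+ 2
                 else (i == j.+1 :> nat)%:R.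

Definition is_max {R : realType} (S : set (\bar R)) (m : \bar R) :=
  S m /\ ubound S m.

(* [mu] is invariant under the transition probabilities [K x A]. *)
Definition stationary d (S : measurableType d) (R : realType)
    (K : S -> set S -> \bar R) (mu : probability S R) :=
  forall A : set S, measurable A -> mu A = (\int[mu]_x K x A)%E.

(* Main.v *)
Require Import Defs.
From HB Require Import structures.
From mathcomp Require Import all_boot all_order all_algebra.
From mathcomp Require Import all_classical all_reals all_analysis.
From mathcomp Require Import complex.
From mathcomp Require Import measurable_realfun ring lra.

Set Implicit Arguments.
Unset Strict Implicit.
Unset Printing Implicit Defensive.

Import Order.TTheory GRing.Theory Num.Theory.
Import numFieldNormedType.Exports.

Local Open Scope classical_set_scope.
Local Open Scope ring_scope.

(* A drift inequality [E V(X_1) + f(X_0) <= V(X_0) + h(X_0)] with [V, f, h >= 0]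
   bounds [\int f] by [\int h] for every invariant probability, whether or not
   [V] is integrable.  It is used three times.

   For the ARCH part, the vector of the [e_{t-i}^2] is dominated by
   [Lambda_t] applied to its predecessor plus [omega eps_t^2], so that the power
   [b s0] of its norm contracts geometrically; hence [sigma_t] has a stationary
   moment of order [2 b s0].

   For [u' = g u + sigma eps], expand [`|u'|^(2 s0)] to second order around
   [g u]: the linear term is centred, [`|g u|^(2 s0)] provides the drift
   [- r `|u|^(2 s0 - rho)], and the term [`|u|^(2 s0 - 2) sigma^2] is split by
   Young's inequality between this drift and [sigma^(2 b s0)]; the condition on
   [b] is what makes the exponents match.

   Finally, the autoregressive polynomial splits over the complex numbers, and
   each factor [z - L] with [|z| > 1] is inverted by a contraction, which carries
   the moment of [u] over to [y]. *)

(** * Inequalities for real powers *)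

Section powR_inequalities.
Context {R : realType}.
Implicit Types a b c h p x y mu : R.

Lemma powR_le1D a x y : 0 <= a -> 0 <= x <= y -> a `^ x <= 1 + a `^ y.
Proof.
move=> a0 /andP[x0 xy]; have [a1|a1] := leP a 1.
  apply: (@le_trans _ _ 1); last by rewrite lerDl powR_ge0.
  have e1 : 1 = 1 `^ x by rewrite powR1.
  by rewrite [leRHS]e1 ge0_ler_powR// nnegrE.
apply: (@le_trans _ _ (a `^ y)); first by rewrite ler_powR// ltW.
by rewrite lerDr.
Qed.

(** Write [mu] as the power [p] of [1 + eta]. If [b <= eta * a], the sum is at most [(1 + eta) * a];
    otherwise it is at most [(1 + eta^-1) * b]. Since [mu] may be taken close to 1, a contraction
    factor on [a] survives the perturbation [b]. *)
Lemma powRD_split p mu : 0 < p -> 1 < mu -> exists2 C, 0 <= C &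
  forall a b, 0 <= a -> 0 <= b -> (a + b) `^ p <= mu * a `^ p + C * b `^ p.
Proof.
move=> p0 mu1; pose eta := mu `^ p^-1 - 1.
have eta0 : 0 < eta.
  have e1 : 1 = 1 `^ p^-1 by rewrite powR1.
  rewrite subr_gt0 [ltLHS]e1.
  by rewrite gt0_ltr_powR ?invr_gt0// nnegrE// ltW// (lt_trans _ mu1).
have mu0 : 0 <= mu by rewrite ltW// (lt_trans _ mu1).
exists ((1 + eta^-1) `^ p); first exact: powR_ge0.
move=> a b a0 b0; have ep : 0 <= 1 + eta^-1 by rewrite addr_ge0// invr_ge0 ltW.
have [ba|ab] := leP b (eta * a).
  apply: (@le_trans _ _ (mu * a `^ p)); last first.
    by rewrite lerDl mulr_ge0 ?powR_ge0.
  have -> : mu = (mu `^ p^-1) `^ p.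
    by rewrite -powRrM mulVf ?gt_eqF// powRr1.
  rewrite -powRM ?powR_ge0//; apply: ge0_ler_powR; rewrite ?nnegrE ?(ltW p0)//.
  - by rewrite addr_ge0.
  - by rewrite mulr_ge0 ?powR_ge0.
  - have -> : mu `^ p^-1 = 1 + eta by rewrite addrC subrK.
    by rewrite mulrDl mul1r lerD2l.
apply: (@le_trans _ _ ((1 + eta^-1) `^ p * b `^ p)); last first.
  by rewrite lerDr mulr_ge0 ?powR_ge0.
rewrite -powRM//; apply: ge0_ler_powR; rewrite ?nnegrE ?(ltW p0)//.
- by rewrite addr_ge0.
- by rewrite mulr_ge0.
- by rewrite mulrDl mul1r addrC lerD2l mulrC ler_pdivlMr// mulrC ltW.
Qed.

(* From [expR (- x) >= 1 - x]. *)
Lemma expR_le_quad x : x <= 2^-1 -> expR x <= 1 + x + 2 * x ^+ 2.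
Proof.
move=> x2; have x1 : 0 < 1 - x by lra.
have : 1 - x <= (expR x)^-1 by rewrite -expRN expR_ge1Dx.
rewrite -[X in X <= _]invrK lef_pV2 ?posrE ?invr_gt0 ?expR_gt0//.
move=> /le_trans; apply; rewrite -[_^-1]mul1r ler_pdivrMr//.
have : 0 <= x ^+ 2 * (1 - 2 * x) by rewrite mulr_ge0 ?sqr_ge0//; lra.
nra.
Qed.

(** For [|t| <= 1 / (2 p)], the left side is [exp (p ln (1 + t)) <= exp (p t)], and the exponential
    is bounded quadratically. For larger [t], [1 <= 2 p |t|] gives [|1 + t| <= (2 p + 1) |t|], while
    the quadratic part is nonnegative because its discriminant is negative. *)
Lemma powR_norm1D_le p t : 1 <= p ->
  `|1 + t| `^ p <= 1 + p * t + 2 * p ^+ 2 * t ^+ 2 + (2 * p + 1) `^ p * `|t| `^ p.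
Proof.
move=> p1; have p0 : 0 < p by lra.
have C0 : 0 <= (2 * p + 1) `^ p * `|t| `^ p by rewrite mulr_ge0 ?powR_ge0.
have [tp|tp] := leP `|t| (2 * p)^-1.
  have tp' : p * `|t| <= 2^-1.
    by move: tp; rewrite -(ler_pM2l p0) invfM mulrCA mulfV ?gt_eqF// mulr1.
  have pt1 : p * t <= 2^-1.
    by rewrite (le_trans _ tp')// ler_wpM2l ?ler_norm// ltW.
  have t1 : `|t| <= 2^-1.
    by rewrite (le_trans _ tp')// ler_peMl.
  have t1' : 0 < 1 + t by have := ler_norm (- t); rewrite normrN; lra.
  rewrite ger0_norm ?(ltW t1')// -[leLHS]addr0 lerD//.
  have := expR_le_quad pt1; rewrite exprMn mulrA; apply: le_trans.
  by rewrite /powR gt_eqF// ler_expR ler_wpM2l ?(ltW p0)// le_ln1Dx//; lra.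
have tp1 : 1 <= 2 * p * `|t|.
  by rewrite mulrC -ler_pdivrMr ?mul1r ?ltW//; lra.
have quad0 : 0 <= 1 + p * t + 2 * p ^+ 2 * t ^+ 2.
  have := ler_norm (- t); rewrite normrN -(real_normK (num_real t)) => tt.
  nra.
rewrite -[leLHS]add0r lerD//.
rewrite -powRM//; last by lra.
apply: ge0_ler_powR; rewrite ?nnegrE; [lra|exact: normr_ge0| |].
  by rewrite mulr_ge0//; lra.
by rewrite (le_trans (ler_normD _ _))// normr1 mulrDl mul1r lerD2r.
Qed.

(* [c] plays the role of the derivative at [a]; the terms linear in [h] vanish
   once a centred [h] is integrated. *)
Lemma powR_normD_le p : 2 <= p -> exists2 C, 0 <= C &
  forall a, exists c, forall h, `|a + h| `^ p <=
    `|a| `^ p + c * h + C * (`|a| `^ (p - 2) * h ^+ 2 + `|h| `^ p).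
Proof.
move=> p2; have p1 : 1 <= p by lra.
pose C := 2 * p ^+ 2 + (2 * p + 1) `^ p.
have C1 : 0 <= 2 * p ^+ 2 by rewrite mulr_ge0// sqr_ge0.
have C2 : 1 <= (2 * p + 1) `^ p.
  have e1 : 1 = 1 `^ p by rewrite powR1.
  by rewrite [leLHS]e1 ge0_ler_powR ?nnegrE//; lra.
exists C; first by rewrite /C; lra.
(* The general case factors [a] out of [a + h]. At [a = 0] the slope 0 suffices, because
   [C >= 1]. *)
move=> a; have [->|a0] := eqVneq a 0.
  exists 0 => h; rewrite add0r mul0r addr0 normr0.
  have h1 : 0 <= 0 `^ (p - 2) * h ^+ 2 by rewrite mulr_ge0 ?powR_ge0// sqr_ge0.
  have h2 := powR_ge0 `|h| p.
  have h3 : 0 `^ p = 0 :> R by rewrite powR0// gt_eqF//; lra.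
  rewrite h3 add0r /C; nra.
exists (p * `|a| `^ p / a) => h.
have na : 0 < `|a| by rewrite normr_gt0.
have -> : a + h = a * (1 + h / a) by field.
rewrite normrM powRM ?normr_ge0//.
have := ler_wpM2l (powR_ge0 `|a| p) (powR_norm1D_le (h / a) p1).
move=> /le_trans; apply.
have e1 : `|a| `^ p * (h / a) ^+ 2 = `|a| `^ (p - 2) * h ^+ 2.
  rewrite powRB; last by rewrite (gt_eqF na) implybT.
  rewrite powR_mulrn ?normr_ge0// real_normK ?num_real// exprMn exprVn.
  by field.
have e2 : `|a| `^ p * `|h / a| `^ p = `|h| `^ p.
  by rewrite -powRM ?normr_ge0// -normrM mulrC divfK.
have h1 : 0 <= `|a| `^ (p - 2) * h ^+ 2 by rewrite mulr_ge0 ?powR_ge0// sqr_ge0.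
have h2 := powR_ge0 `|h| p.
rewrite !mulrDr mulr1 [X in _ + X <= _]mulrCA e2.
rewrite [X in _ + X + _ <= _]mulrCA e1.
have -> : `|a| `^ p * (p * (h / a)) = p * `|a| `^ p / a * h by ring.
rewrite -!addrA lerD2l lerD2l /C; nra.
Qed.

(** Compare [v] with [eta] times the power [2 - rho] of [u]. A smaller [v] is absorbed into the
    power [p - rho] of [u]; for a larger one, [u] is bounded by a power of [v], which leaves [v] to
    the power [k + 1 = (p - rho) / (2 - rho)], at most [e]. *)
Lemma powR_young p rho e (c eps : R) : 2 <= p -> 0 < rho < 2 ->
  (p - rho) / (2 - rho) <= e -> 0 < eps -> 0 <= c -> exists2 C, 0 <= C &
  forall u v, 0 < u -> 0 <= v ->
    c * (u `^ (p - 2) * v) <= eps * u `^ (p - rho) + C * (1 + v `^ e).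
Proof.
move=> p2 /andP[rho0 rho2] pe eps0 c0.
have d0 : 0 < 2 - rho by lra.
(* Chosen so that [c * eta <= eps]; the added 1 covers [c = 0]. *)
pose eta := eps / (c + 1); pose k := (p - 2) / (2 - rho).
have c1 : 0 < c + 1 by lra.
have eta0 : 0 < eta by rewrite divr_gt0.
have k0 : 0 <= k by rewrite divr_ge0//; lra.
exists (c * eta^-1 `^ k) => [|u v u0 v0]; first by rewrite mulr_ge0 ?powR_ge0.
have [vu|uv] := leP v (eta * u `^ (2 - rho)).
  apply: (@le_trans _ _ (eps * u `^ (p - rho))); last first.
    by rewrite lerDl mulr_ge0 ?mulr_ge0 ?powR_ge0// addr_ge0 ?powR_ge0.
  apply: (@le_trans _ _ ((c * eta) * u `^ (p - rho))).
    rewrite -mulrA ler_wpM2l//.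
    have -> : p - rho = (p - 2) + (2 - rho) by ring.
    rewrite [u `^ (_ + (2 - _))]powRD; last by rewrite (gt_eqF u0) implybT.
    by rewrite mulrCA ler_wpM2l ?powR_ge0.
  rewrite ler_wpM2r ?powR_ge0// /eta mulrCA ler_piMr ?(ltW eps0)//.
  by rewrite ler_pdivrMr// mul1r; lra.
have v1 : 0 < v by apply: le_lt_trans uv; rewrite mulr_ge0 ?powR_ge0 ?ltW.
apply: (@le_trans _ _ (c * eta^-1 `^ k * (1 + v `^ e))); last first.
  by rewrite lerDr mulr_ge0 ?powR_ge0 ?ltW.
rewrite -mulrA ler_wpM2l//.
apply: (@le_trans _ _ (eta^-1 `^ k * v `^ (k + 1))); last first.
  rewrite ler_wpM2l ?powR_ge0// powR_le1D//; apply/andP; split; first lra.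
  by apply: le_trans pe; rewrite le_eqVlt; apply/orP; left; apply/eqP; rewrite /k; field; lra.
rewrite [v `^ _]powRD; last by rewrite (gt_eqF v1) implybT.
rewrite powRr1// mulrA ler_wpM2r// -powRM ?invr_ge0 ?(ltW eta0)//.
have -> : p - 2 = (2 - rho) * k by rewrite /k; field; lra.
rewrite powRrM; apply: ge0_ler_powR; rewrite ?nnegrE ?powR_ge0//.
  by rewrite mulr_ge0 ?invr_ge0 ?(ltW eta0).
by rewrite mulrC ler_pdivlMr// mulrC ltW.
Qed.

Lemma powR_le_id a p : 0 <= a <= 1 -> 1 <= p -> a `^ p <= a.
Proof.
move=> /andP[a0 a1] p1; have [->|a_neq0] := eqVneq a 0.
  by rewrite powR0// gt_eqF//; lra.
by rewrite ge1r_powR// a1 lt_neqAle eq_sym a_neq0 a0.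
Qed.

(* The drift of [u |-> `|u| `^ p] along [u' = g u + sqrt v * eps], once the
   innovation has been integrated out. *)
Lemma subgeometric_drift (g : R -> R) r M0 K0 p rho e C :
  0 < r -> 0 < M0 -> 0 < K0 -> 0 < rho < 2 ->
  (forall u, M0 <= `|u| -> `|g u| <= (1 - r * `|u| `^ (- rho)) * `|u|) ->
  (forall u, `|u| <= M0 -> `|g u| <= K0) ->
  2 <= p -> (p - rho) / (2 - rho) <= e -> p / 2 <= e -> 0 <= C ->
  exists2 D, 0 <= D & forall u v, 0 <= v ->
    `|g u| `^ p + C * (`|g u| `^ (p - 2) * v + v `^ (p / 2)) +
      r / 2 * `|u| `^ (p - rho) <= `|u| `^ p + D * (1 + v `^ e).
Proof.
move=> r0 M00 K00 hrho gl gs p2 pe p2e C0.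
have r20 : 0 < r / 2 by lra.
(* Half of the decrease supplied by [g] absorbs the cross term; the other half remains in the
   conclusion. *)
have [D D0 HD] := @powR_young p rho e C (r / 2) p2 hrho pe r20 C0.
have /andP[rho0 rho2] := hrho.
(* On [|u| <= M0] nothing decreases: every term in [u] is bounded there and charged to this
   constant. *)
pose D1 := K0 `^ p + C * K0 `^ (p - 2) + r / 2 * M0 `^ (p - rho).
have D10 : 0 <= D1.
  apply: addr_ge0; last by rewrite mulr_ge0 ?powR_ge0 ?(ltW r20).
  by apply: addr_ge0; [exact: powR_ge0|rewrite mulr_ge0 ?powR_ge0].
exists (D1 + D + C) => [|u v v0]; first by rewrite (addr_ge0 (addr_ge0 D10 D0) C0).
have ve0 := powR_ge0 v e.
have vp : C * v `^ (p / 2) <= C * (1 + v `^ e).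
  by rewrite ler_wpM2l// powR_le1D//; apply/andP; split => //; lra.
have DD : 0 <= D * (1 + v `^ e) by rewrite mulr_ge0// addr_ge0.
have [uM|Mu] := leP `|u| M0.
  have gK := gs _ uM.
  have h1 : `|g u| `^ p <= K0 `^ p.
    by rewrite ge0_ler_powR ?nnegrE ?(ltW K00)//; lra.
  have h2 : C * (`|g u| `^ (p - 2) * v) <= C * K0 `^ (p - 2) * (1 + v `^ e).
    rewrite -mulrA ler_wpM2l// ler_pM ?powR_ge0//.
      by rewrite ge0_ler_powR ?nnegrE ?(ltW K00)//; lra.
    rewrite -{1}(powRr1 v0) powR_le1D//; apply/andP; split => //; lra.
  have h3 : r / 2 * `|u| `^ (p - rho) <= r / 2 * M0 `^ (p - rho).
    rewrite ler_wpM2l ?(ltW r20)//.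
    by rewrite ge0_ler_powR ?nnegrE ?(ltW M00)//; lra.
  have h4 := powR_ge0 `|u| p.
  have h5 : 0 <= (K0 `^ p + r / 2 * M0 `^ (p - rho)) * v `^ e.
    by rewrite mulr_ge0// addr_ge0 ?powR_ge0// mulr_ge0 ?powR_ge0 ?(ltW r20).
  rewrite /D1; nra.
have u0 : 0 < `|u| by exact: lt_trans Mu.
have gu := gl _ (ltW Mu); set tau := r * `|u| `^ (- rho) in gu.
have tau0 : 0 <= tau by rewrite mulr_ge0 ?powR_ge0// ltW.
(* [M0] need not be large enough to give this sign; it comes from [0 <= |g u|]. *)
have t1 : 0 <= 1 - tau by rewrite -(pmulr_lge0 _ u0) (le_trans _ gu).
(* As [1 - tau] lies in [[0, 1]] and [p >= 1], its power [p] is at most [1 - tau] itself. *)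
have h1 : `|g u| `^ p <= `|u| `^ p - r * `|u| `^ (p - rho).
  apply: (@le_trans _ _ (((1 - tau) * `|u|) `^ p)).
    by rewrite ge0_ler_powR ?nnegrE ?mulr_ge0//; lra.
  rewrite powRM//; apply: (@le_trans _ _ ((1 - tau) * `|u| `^ p)).
    by rewrite ler_wpM2r ?powR_ge0// powR_le_id//; [apply/andP; split|]; lra.
  rewrite mulrBl mul1r /tau -mulrA -powRD; last by rewrite (gt_eqF u0) implybT.
  by rewrite [- rho + p]addrC.
have h2 : `|g u| `^ (p - 2) * v <= `|u| `^ (p - 2) * v.
  rewrite ler_wpM2r// ge0_ler_powR ?nnegrE//; first lra.
  by rewrite (le_trans gu)// ler_piMl//; lra.
have h3 := HD `|u| v u0 v0.
have h4 := ler_wpM2l C0 h2.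
have h5 : 0 <= D1 * (1 + v `^ e) by rewrite mulr_ge0// addr_ge0.
lra.
Qed.

End powR_inequalities.

(** * Drift inequalities under an invariant probability *)

Section stationary_drift.
Local Open Scope ereal_scope.
Context {R : realType} d1 d2 (S : measurableType d1) (T : measurableType d2).
Variables (P : probability T R) (F : S * T -> S) (mF : measurable_fun setT F).
Variables (mu : probability S R).
Hypothesis mu_stationary :
  stationary (fun x A => P [set w | A (F (x, w))]) mu.

(** Invariance says that [mu] is the image of the product [mu \x P] under [F]; the rest is
    Tonelli. *)
Lemma stationary_integral (f : S -> \bar R) : measurable_fun setT f ->
  (forall x, 0 <= f x) -> \int[mu]_x f x = \int[mu]_x \int[P]_w f (F (x, w)).
Proof.
move=> mf f0; pose m := pushforward (mu \x P) F.
have -> : \int[mu]_x f x = \int[m]_x f x.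
  apply: eq_measure_integral => A mA _.
  apply: (etrans (mu_stationary mA)); rewrite /m /pushforward /= /product_measure1.
  apply: eq_integral => x _ /=; congr (P _).
  by apply/seteqP; split => w /=; rewrite /xsection/= inE.
rewrite ge0_integral_pushforward//= preimage_setT.
by rewrite fubini_tonelli1//=; exact: measurableT_comp.
Qed.

(* [V] need not be [mu]-integrable: the drift inequality survives the truncation
   of [V] at [n] on [V <= n], and is trivial on [V > n]. *)
Lemma stationary_drift (V f : S -> R) (h : S -> \bar R) :
  measurable_fun setT V -> measurable_fun setT f -> measurable_fun setT h ->
  (forall x, 0 <= V x)%R -> (forall x, 0 <= f x)%R -> (forall x, 0 <= h x) ->
  (forall x, \int[P]_w (V (F (x, w)))%:E + (f x)%:E <= (V x)%:E + h x) ->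
  \int[mu]_x (f x)%:E <= \int[mu]_x h x.
Proof.
move=> mV mf mh V0 f0 h0 drift.
pose fn (n : nat) x := (if (V x <= n%:R)%R then f x else 0%R)%:E.
pose Vn (n : nat) x := (Num.min (V x) n%:R)%:E.
have Vn0 n x : 0 <= Vn n x by rewrite lee_fin le_min V0/=.
have mVn n : measurable_fun setT (Vn n).
  by apply/measurable_EFinP; exact: measurable_minr.
have fn0 n x : 0 <= fn n x by rewrite lee_fin; case: ifP.
have mfn n : measurable_fun setT (fn n).
  apply/measurable_EFinP; apply: measurable_fun_ifT => //.
  exact: measurable_fun_ler.
have mVF x : measurable_fun setT (fun w => V (F (x, w))).
  by apply: measurableT_comp => //; exact: measurableT_comp.
have mVnF n x : measurable_fun setT (fun w => Vn n (F (x, w))).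
  by apply: measurableT_comp => //; exact: measurableT_comp.
have drift_n n x : \int[P]_w Vn n (F (x, w)) + fn n x <= Vn n x + h x.
  rewrite /fn /Vn; case: ifPn => Vx.
    rewrite (min_idPl Vx); apply: le_trans (drift x).
    rewrite leeD2r//; apply: ge0_le_integral => //=.
    - by move=> w _; exact: Vn0.
    - exact: mVnF.
    - exact/measurable_EFinP/mVF.
    - by move=> w _; rewrite lee_fin ge_min lexx.
  rewrite adde0 (min_idPr _); last by rewrite ltW// ltNge.
  apply: (@le_trans _ _ n%:R%:E); last by rewrite leeDl.
  have -> : n%:R%:E = \int[P]_w (n%:R%:E : \bar R).
    by rewrite integral_cst//= probability_setT mule1.
  apply: ge0_le_integral => //=.
  - by move=> w _; exact: Vn0.
  - exact: mVnF.
  - by move=> w _; rewrite lee_fin ge_min lexx orbT.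
have int_fn n : \int[mu]_x fn n x <= \int[mu]_x h x.
  (* The truncation makes this integral finite, so that, after invariance has rewritten one copy, it
     cancels from both sides. *)
  have Vfin : \int[mu]_x Vn n x \is a fin_num.
    rewrite ge0_fin_numE; last exact: integral_ge0.
    apply: (@le_lt_trans _ _ (\int[mu]_x (n%:R%:E : \bar R))).
      by apply: ge0_le_integral => //= x _; rewrite lee_fin ge_min lexx orbT.
    by rewrite integral_cst//= probability_setT mule1 ltry.
  rewrite -(leeD2lE _ _ Vfin) {1}stationary_integral//.
  rewrite -!ge0_integralD//; last 2 first.
    by move=> x _; exact: integral_ge0.
    apply: (measurable_fun_fubini_tonelli_F (fun z => Vn n (F z))) => //.
    exact: measurableT_comp.
  apply: ge0_le_integral => //.
  - by move=> x _; rewrite adde_ge0// integral_ge0.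
  - apply: emeasurable_funD => //.
    apply: (measurable_fun_fubini_tonelli_F (fun z => Vn n (F z))) => //.
    exact: measurableT_comp.
  - exact: emeasurable_funD.
(* Since [V x] is a real number, [fn n x] equals [f x] as soon as [n >= V x]; monotone convergence
   then removes the truncation. *)
have -> : \int[mu]_x (f x)%:E = \int[mu]_x limn (fn ^~ x).
  apply: eq_integral => x _; apply/esym/cvg_lim => //.
  apply: cvg_near_cst; exists (Num.truncn (V x)).+1 => // n /= xn.
  rewrite /fn ifT//; apply: (le_trans (ltW (truncnS_gt _))).
  by rewrite ler_nat.
rewrite monotone_convergence//; last first.
  move=> x _ n m nm; rewrite lee_fin; case: ifPn => Vx; last by case: ifP.
  by rewrite ifT// (le_trans Vx)// ler_nat.
apply: lime_le; last exact: nearW.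
apply: ereal_nondecreasing_is_cvgn => n m nm; apply: ge0_le_integral => //.
move=> x _; rewrite lee_fin; case: ifPn => Vx; last by case: ifP.
by rewrite ifT// (le_trans Vx)// ler_nat.
Qed.

End stationary_drift.

(** * Monotone norms and their measurability *)

Section monotone_norm_theory.
Context {R : realType} (q : nat) (N : 'cV[R]_q -> R).
Hypothesis HN : monotone_norm N.
Implicit Types (x y : 'cV[R]_q).

Lemma normZ_mono a x : N (a *: x) = `|a| * N x.
Proof. by case: HN => -[]. Qed.

Lemma normD_mono x y : N (x + y) <= N x + N y.
Proof. by case: HN => -[]. Qed.

Lemma norm_mono x y : (forall i, `|x i 0| <= `|y i 0|) -> N x <= N y.
Proof. by case: HN => _; apply. Qed.

Lemma norm_mono0 : N 0 = 0.
Proof. by rewrite -(scale0r 0) normZ_mono normr0 mul0r. Qed.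

Lemma norm_mono_ge0 x : 0 <= N x.
Proof.
have := normD_mono x (- x); rewrite subrr norm_mono0.
by rewrite -scaleN1r normZ_mono normrN1 mul1r; lra.
Qed.

Lemma norm_mono_eq0 x : N x = 0 -> x = 0.
Proof. by case: HN => -[+ _ _ _]; apply. Qed.

Lemma norm_mono_delta_gt0 (i : 'I_q) : 0 < N (delta_mx i 0).
Proof.
rewrite lt_neqAle norm_mono_ge0 andbT eq_sym; apply/eqP => /norm_mono_eq0.
by move=> /colP/(_ i); rewrite !mxE !eqxx => /eqP; rewrite oner_eq0.
Qed.

Lemma measurable_norm_mono d (S : measurableType d) (f : 'I_q -> S -> R) :
  (forall i, measurable_fun setT (f i)) ->
  measurable_fun setT (fun s => N (\col_i f i s)).
Proof.
move=> mf; apply: (measurability _ (RGenInftyO.measurableE R)).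
move=> _ [_ [c ->] <-]; rewrite setTI.
(* By monotonicity [N v < c] iff [v] lies in some rational box [-w, w] with
   [N w < c]. *)
have -> : (fun s => N (\col_i f i s)) @^-1` `]-oo, c[%classic =
   \bigcup_(w : {ffun 'I_q -> rat}) [set s | N (\col_i ratr (w i)) < c /\
     (\bigcap_(i in [set: 'I_q]) (f i @^-1` `[- `|ratr (w i)|, `|ratr (w i)|]%classic)) s].
  apply/seteqP; split => s /=; rewrite in_itv/=; last first.
    move=> [w _ /= [wc ws]]; apply: le_lt_trans wc; apply: norm_mono => i.
    have := ws i I; rewrite /= in_itv/= !mxE => ?; by rewrite ler_norml.
  move=> sc; pose one := \col_(i < q) (1 : R).
  (* Raising each coordinate by at most [del] costs at most [del * N one], which is less than the
     gap to [c]. The added 1 keeps the denominator positive even when [q = 0]. *)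
  pose del := (c - N (\col_i f i s)) / (1 + N one).
  have N1 : 0 < 1 + N one by rewrite ltr_pwDl// norm_mono_ge0.
  have del0 : 0 < del by rewrite divr_gt0// subr_gt0.
  have ex i : {w : rat | `|f i s| < ratr w < `|f i s| + del}.
    have /rat_in_itvoo : `|f i s| < `|f i s| + del by rewrite ltrDl.
    by move/cid => [w]; rewrite in_itv/=; exists w.
  exists [ffun i => sval (ex i)] => //=; split.
    pose v := \col_i `|f i s|.
    apply: (@le_lt_trans _ _ (N (v + del *: one))).
      apply: norm_mono => i; rewrite !mxE ffunE.
      case: (ex i) => /= w /andP[w1 w2].
      apply: le_trans (ler_norm _); rewrite mulr1 ger0_norm ?(ltW w2)//.
      by rewrite (le_trans _ (ltW w1)).
    apply: le_lt_trans (normD_mono _ _) _.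
    have -> : N v = N (\col_i f i s).
      apply/le_anti/andP; split; apply: norm_mono => i; rewrite !mxE normr_id//.
    rewrite normZ_mono gtr0_norm// -ltrBrDl /del.
    rewrite mulrAC ltr_pdivrMr// ltr_pM2l ?subr_gt0//; lra.
  move=> i _ /=; rewrite in_itv/= ffunE -ler_norml.
  case: (ex i) => /= w /andP[w1 _].
  exact: le_trans (ltW w1) (ler_norm _).
apply: countable_bigcupT_measurable => [|w]; first exact: countableP.
have [wc|wc] := boolP (N (\col_i ratr (w i)) < c); last first.
  rewrite [X in measurable X](_ : _ = set0)//.
  by apply/seteqP; split => // s /= [].
rewrite [X in measurable X](_ : _ = \bigcap_(i in [set: 'I_q])
    (f i @^-1` `[- `|ratr (w i)|, `|ratr (w i)|]%classic)).
  apply: fin_bigcap_measurable => // i _.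
  by rewrite -[X in measurable X]setTI; exact: mf.
by apply/seteqP; split => [s /= []|].
Qed.

End monotone_norm_theory.

(** * Integrals of functions of the innovation *)

Section innovation_integrals.
Context {R : realType} d (T : measurableType d) (P : probability T R).

Lemma ge0_integral_comb (Y Z : T -> R) (k l : R) :
  measurable_fun setT Y -> measurable_fun setT Z ->
  (forall w, 0 <= Y w) -> (forall w, 0 <= Z w) -> 0 <= k -> 0 <= l ->
  (\int[P]_w (k * Y w + l * Z w)%:E =
   k%:E * \int[P]_w (Y w)%:E + l%:E * \int[P]_w (Z w)%:E)%E.
Proof.
move=> mY mZ Y0 Z0 k0 l0.
under eq_integral do rewrite EFinD !EFinM.
rewrite ge0_integralD//=; last 4 first.
- by move=> w _; rewrite -EFinM lee_fin mulr_ge0.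
- by apply: measurable_funeM; exact/measurable_EFinP.
- by move=> w _; rewrite -EFinM lee_fin mulr_ge0.
- by apply: measurable_funeM; exact/measurable_EFinP.
by rewrite !ge0_integralZl_EFin//; try exact/measurable_EFinP;
  move=> w _; rewrite lee_fin.
Qed.

Lemma ge0_integral_affine (Y : T -> R) (k l : R) :
  measurable_fun setT Y -> (forall w, 0 <= Y w) -> 0 <= k -> 0 <= l ->
  (\int[P]_w (k + l * Y w)%:E = k%:E + l%:E * \int[P]_w (Y w)%:E)%E.
Proof.
move=> mY Y0 k0 l0; 
rewrite (eq_integral (fun w => (k * cst 1 w + l * Y w)%:E)); last first.
  by move=> w _; rewrite mulr1.
rewrite ge0_integral_comb//; congr (_ + _)%E.
by rewrite (integral_cst P measurableT (1:R)%:E)/=; rewrite probability_setT !mule1.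
Qed.

(** Transfers finiteness of a moment. With [k = 0] it also removes the constant factor that a drift
    inequality leaves in front of the function of interest. *)
Lemma ge0_integral_le_affine_lty (Y Z : T -> R) (k l : R) :
  measurable_fun setT Y -> measurable_fun setT Z ->
  (forall w, 0 <= Y w) -> (forall w, 0 <= Z w) -> 0 <= k -> 0 <= l ->
  (forall w, Z w <= k + l * Y w) ->
  (\int[P]_w (Y w)%:E < +oo)%E -> (\int[P]_w (Z w)%:E < +oo)%E.
Proof.
move=> mY mZ Y0 Z0 k0 l0 ZY Yoo.
apply: (@le_lt_trans _ _ (\int[P]_w (k + l * Y w)%:E)%E).
  apply: ge0_le_integral => //.
  - by move=> w _; rewrite lee_fin.
  - exact/measurable_EFinP.
  - by apply/measurable_EFinP; apply: measurable_funD => //; exact: measurable_funM.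
  - by move=> w _; rewrite lee_fin.
rewrite ge0_integral_affine// lte_add_pinfty ?ltry//.
by rewrite lte_mul_pinfty// integral_ge0.
Qed.

Context (X : {RV P >-> R}).
Hypotheses (X_mean : ('E_P[X] = 0)%E) (X_var : ('V_P[X] = 1)%E).

Lemma integral_sqr_standard : (\int[P]_w (X w ^+ 2)%:E = 1)%E.
Proof.
move: X_var; rewrite /variance unlock X_mean/= unlock => <-.
by apply: eq_integral => w _ /=; rewrite /GRing.mul /= subr0.
Qed.

Lemma integrable_standard : P.-integrable setT (EFin \o X).
Proof.
have mX : measurable_fun setT X by [].
apply: (@le_integrable _ _ _ P setT measurableT _ (fun w => (1 + 1 * X w ^+ 2)%:E)).
- exact/measurable_EFinP.
- move=> w _ /=; rewrite lee_fin mul1r [leRHS]ger0_norm ?addr_ge0 ?sqr_ge0//.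
  rewrite -(real_normK (num_real (X w))).
  have := sqr_ge0 (`|X w| - 1); have := normr_ge0 (X w); nra.
- apply/integrableP; split.
    by apply/measurable_EFinP; apply: measurable_funD => //;
      apply: measurable_funM => //; exact: measurable_funX.
  rewrite (eq_integral (fun w => (1 + 1 * X w ^+ 2)%:E)); last first.
    by move=> w _; rewrite gee0_abs// lee_fin addr_ge0// mul1r sqr_ge0.
  rewrite (ge0_integral_affine (Y := fun w => X w ^+ 2))//.
  + by rewrite integral_sqr_standard mul1e ltry.
  + exact: measurable_funX.
  + by move=> w; exact: sqr_ge0.
Qed.

(** Integrate the expansion around [a]: the slope depends on [a] alone, so the linear term vanishes
    with the mean, the square contributes 1, and the power [p] contributes its moment [M]. *)
Lemma integral_powR_normD p : 2 <= p ->
  (\int[P]_w (`|X w| `^ p)%:E < +oo)%E ->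
  exists2 C, 0 <= C & forall a s, 0 <= s ->
    (\int[P]_w (`|a + s * X w| `^ p)%:E <=
     (`|a| `^ p + C * (`|a| `^ (p - 2) * s ^+ 2 + s `^ p))%:E)%E.
Proof.
move=> p2 Xp; have mX : measurable_fun setT X by [].
have mX2 : measurable_fun setT (fun w => X w ^+ 2) by exact: measurable_funX.
have mXp : measurable_fun setT (fun w => `|X w| `^ p).
  apply: (measurableT_comp (measurable_powR _)) => //.
  exact: measurableT_comp.
have [C C0 HC] := powR_normD_le p2.
pose M := fine (\int[P]_w (`|X w| `^ p)%:E).
have M0 : 0 <= M by apply: fine_ge0; apply: integral_ge0 => w _; rewrite lee_fin powR_ge0.
have EM : (\int[P]_w (`|X w| `^ p)%:E)%E = M%:E.
  rewrite fineK// ge0_fin_numE//.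
  by apply: integral_ge0 => w _; rewrite lee_fin powR_ge0.
exists (C * (1 + M)) => [|a s s0]; first by rewrite mulr_ge0// addr_ge0.
have [c Hc] := HC a.
pose Y w := C * `|a| `^ (p - 2) * s ^+ 2 * X w ^+ 2 + C * s `^ p * `|X w| `^ p.
have k1 : 0 <= C * `|a| `^ (p - 2) * s ^+ 2.
  by rewrite mulr_ge0 ?sqr_ge0// mulr_ge0 ?powR_ge0.
have k2 : 0 <= C * s `^ p by rewrite mulr_ge0 ?powR_ge0.
have Y0 w : 0 <= Y w by rewrite /Y addr_ge0// mulr_ge0 ?powR_ge0 ?sqr_ge0.
have mY : measurable_fun setT Y.
  by apply: measurable_funD; apply: measurable_funM.
have EY : (\int[P]_w (`|a| `^ p + 1 * Y w)%:E =
   (`|a| `^ p + (C * `|a| `^ (p - 2) * s ^+ 2 + C * s `^ p * M))%:E)%E.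
  rewrite ge0_integral_affine ?powR_ge0// mul1e.
  rewrite (ge0_integral_comb mX2 mXp (fun w => sqr_ge0 _) (fun w => powR_ge0 _ _) k1 k2).
  by rewrite integral_sqr_standard EM mule1.
have mZ : measurable_fun setT (fun w => `|a| `^ p + 1 * Y w).
  by apply: measurable_funD => //; exact: measurable_funM.
(* The linear term has no sign, so the integral is split by integrability rather than by
   nonnegativity. *)
have iZ : P.-integrable setT (fun w => (`|a| `^ p + 1 * Y w)%:E).
  apply/integrableP; split; first exact/measurable_EFinP.
  rewrite (eq_integral (fun w => (`|a| `^ p + 1 * Y w)%:E)); last first.
    by move=> w _; rewrite gee0_abs// lee_fin addr_ge0 ?powR_ge0 ?mul1r.
  by rewrite EY ltry.
have iX : P.-integrable setT (fun w => (c * s)%:E * (X w)%:E)%E.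
  by apply: integrableZl => //; exact: integrable_standard.
apply: (@le_trans _ _ (\int[P]_w ((`|a| `^ p + 1 * Y w)%:E + (c * s)%:E * (X w)%:E))%E).
  apply: ge0_le_integral => //.
  - apply/measurable_EFinP/(measurableT_comp (measurable_powR _)).
    apply: measurableT_comp => //; apply: measurable_funD => //.
    exact: measurable_funM.
  - apply: emeasurable_funD; first exact/measurable_EFinP.
    by apply: measurable_funeM; exact/measurable_EFinP.
  - move=> w _; rewrite -EFinM -EFinD lee_fin (le_trans (Hc _))//.
    rewrite normrM powRM// (ger0_norm s0) exprMn /Y.
    rewrite le_eqVlt; apply/orP; left; apply/eqP; ring.
rewrite integralD// EY integralZl//; last exact: integrable_standard.
move: X_mean; rewrite unlock => ->; rewrite mule0 adde0 lee_fin lerD2l.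
have h1 : 0 <= `|a| `^ (p - 2) * s ^+ 2 by rewrite mulr_ge0 ?powR_ge0 ?sqr_ge0.
have h2 := powR_ge0 s p.
set u := `|a| `^ (p - 2) * s ^+ 2 in h1 *.
rewrite -(mulrA C _ (s ^+ 2)) -/u.
have : 0 <= C * (s `^ p + M * u) by rewrite mulr_ge0// addr_ge0// mulr_ge0.
nra.
Qed.

End innovation_integrals.

(** * Contraction in mean by the random matrix *)

Section contraction.
Context {R : realType} d (T : measurableType d) (P : probability T R)
  (X : {RV P >-> R}) (q : nat) (alpha : 'I_q -> R) (N : 'cV[R]_q -> R) (p : R)
  (m : \bar R).
Hypotheses (HN : monotone_norm N) (p0 : 0 < p).
Hypotheses (m_max : is_max
    [set ('E_P[fun w => (N (Lambda alpha (X w) *m x) `^ p)%R] `^ p^-1)%E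
    | x in [set x : 'cV[R]_q | N x = 1]] m) (m1 : (m < 1)%E).

Lemma measurable_norm_Lambda (v : 'cV[R]_q) :
  measurable_fun setT (fun w => N (Lambda alpha (X w) *m v)).
Proof.
have -> : (fun w => N (Lambda alpha (X w) *m v)) =
    (fun w => N (\col_i (Lambda alpha (X w) *m v) i 0)).
  by apply/funext => w; congr N; apply/colP => i; rewrite [RHS]mxE.
apply: (measurable_norm_mono HN (f := fun i w => (Lambda alpha (X w) *m v) i 0)).
move=> i; have -> : (fun w => (Lambda alpha (X w) *m v) i 0) =
    (fun w => \sum_j (if i == 0 :> nat then alpha j * X w ^+ 2
                 else (i == j.+1 :> nat)%:R) * v j 0).
  by apply/funext => w; rewrite mxE; apply: eq_bigr => j _; rewrite mxE.
have mX : measurable_fun setT X by [].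
apply: measurable_sum => j; apply: measurable_funM => //.
case: (i == 0 :> nat) => //; apply: measurable_funM => //; exact: measurable_funX.
Qed.

(** Homogeneity carries the bound from the unit sphere to every [v], with [lam] the power [p] of the
    maximum [m]; [v = 0] cannot be normalized and is treated apart. *)
Lemma Lambda_moment_contract : exists2 lam, 0 <= lam < 1 & forall v,
  (\int[P]_w (N (Lambda alpha (X w) *m v) `^ p)%:E <= (lam * N v `^ p)%:E)%E.
Proof.
case: m_max => -[x0 _ m_eq] m_ub.
have m0 : (0 <= m)%E by rewrite -m_eq poweR_ge0.
have mfin : m \is a fin_num by rewrite ge0_fin_numE// (lt_trans m1)// ltry.
have fm0 : 0 <= fine m by rewrite fine_ge0.
have fm1 : fine m < 1 by rewrite -lte_fin fineK.
exists (fine m `^ p).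
  rewrite powR_ge0/=; have e1 : 1 = 1 `^ p by rewrite powR1.
  by rewrite [ltRHS]e1 gt0_ltr_powR// nnegrE.
move=> v; have [->|v0] := eqVneq v 0.
  rewrite norm_mono0// powR0 ?gt_eqF// mulr0 integral0_eq// => w _.
  by rewrite mulmx0 norm_mono0// powR0// gt_eqF.
have Nv0 : 0 < N v.
  rewrite lt_neqAle norm_mono_ge0// andbT eq_sym.
  by apply: contra_neq v0 => /(norm_mono_eq0 HN).
pose x := (N v)^-1 *: v.
have Nx : N x = 1.
  by rewrite normZ_mono// gtr0_norm ?invr_gt0// mulVf// gt_eqF.
have vx : v = N v *: x by rewrite scalerA mulfV ?gt_eqF// scale1r.
have Ex : (\int[P]_w (N (Lambda alpha (X w) *m x) `^ p)%:E <= (fine m `^ p)%:E)%E.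
  have : ('E_P[fun w => (N (Lambda alpha (X w) *m x) `^ p)%R] `^ p^-1 <= m)%E.
    by apply: m_ub; exists x.
  rewrite unlock -(fineK mfin) => /(gt0_ler_poweR (ltW p0)).
  rewrite -poweRrM mulVf ?gt_eqF// poweRe1; last first.
    by apply: integral_ge0 => w _; rewrite lee_fin powR_ge0.
  rewrite poweR_EFin; apply.
    by rewrite in_itv/= poweR_ge0 leey.
  by rewrite in_itv/= lee_fin fm0 leey.
rewrite (eq_integral (fun w => (N v `^ p)%:E * (N (Lambda alpha (X w) *m x) `^ p)%:E)%E).
  rewrite ge0_integralZl_EFin ?powR_ge0//.
  - by rewrite mulrC EFinM lee_wpmul2l// lee_fin powR_ge0.
  - by move=> w _; rewrite lee_fin powR_ge0.
  - apply/measurable_EFinP; apply: (measurableT_comp (measurable_powR _)).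
    exact: measurable_norm_Lambda.
move=> w _; rewrite [in LHS]vx -scalemxAr normZ_mono// gtr0_norm//.
by rewrite powRM ?norm_mono_ge0// ltW.
Qed.

(* Only the coordinate vectors are tested: [Lambda z delta_j >= alpha_j z^2 delta_0]. *)
Lemma Lambda_moment_finite (hq : (0 < q)%N) j : 0 <= alpha j -> alpha j != 0 ->
  (\int[P]_w ((X w ^+ 2) `^ p)%:E < +oo)%E.
Proof.
move=> aj0 aj; have [lam _ Hlam] := Lambda_moment_contract.
pose i0 := Ordinal hq.
pose c := (alpha j * N (delta_mx i0 0)) `^ p.
have Nd := norm_mono_delta_gt0 HN i0.
have c0 : 0 < c by rewrite powR_gt0// mulr_gt0// lt_neqAle eq_sym aj.
have mX : measurable_fun setT X by [].
have mX2 : measurable_fun setT (fun w => (X w ^+ 2) `^ p).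
  by apply: (measurableT_comp (measurable_powR _)); exact: measurable_funX.
have le : (c%:E * \int[P]_w ((X w ^+ 2) `^ p)%:E <=
    (lam * N (delta_mx j 0) `^ p)%:E)%E.
  apply: le_trans (Hlam _); rewrite -ge0_integralZl_EFin ?(ltW c0)//; last 2 first.
  - by move=> w _; rewrite lee_fin powR_ge0.
  - exact/measurable_EFinP.
  apply: ge0_le_integral => //.
  - by move=> w _; rewrite -EFinM lee_fin mulr_ge0 ?powR_ge0.
  - by apply: measurable_funeM; exact/measurable_EFinP.
  - apply/measurable_EFinP; apply: (measurableT_comp (measurable_powR _)).
    exact: measurable_norm_Lambda.
  move=> w _; rewrite -EFinM lee_fin /c -powRM ?sqr_ge0//; last first.
    by rewrite mulr_ge0// ltW.
  rewrite ge0_ler_powR ?nnegrE ?norm_mono_ge0 ?(ltW p0)//.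
    by rewrite mulr_ge0 ?sqr_ge0// mulr_ge0// ltW.
  rewrite mulrAC -[X in X * _]ger0_norm; last by rewrite mulr_ge0 ?sqr_ge0.
  rewrite -normZ_mono//; apply: norm_mono => // i.
  rewrite !mxE (bigD1 j)//= big1 ?addr0; last first.
    by move=> k kj; rewrite !mxE (negbTE kj) mulr0.
  rewrite !mxE !eqxx/= !mulr1 andbT.
  have [->|ii] := eqVneq i i0; first by rewrite mulr1.
  by rewrite mulr0 normr0.
rewrite ltey; apply/eqP => E; move: le; rewrite E mulry gtr0_sg// mul1e.
by rewrite leye_eq.
Qed.

End contraction.

(** * Algebra of the state recursion *)

Section model_algebra.
Context {R : realType} (p q : nat).
Variables (ar : 'I_p.-1 -> R) (g : R -> R) (omega : R) (alpha : 'I_q -> R)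
  (zeta : 'I_q.+1 -> (p + q).-tuple R -> R).
Hypotheses (hp : (1 <= p)%N) (hq : (1 <= q)%N).
Implicit Types (x : (p + q).-tuple R) (z : R).

Local Notation next := (next_state ar g omega alpha zeta).

(* If [x] is the state at time $t$, then [ulag x j], [elag x j], [vol x] and
   [evec x] are $u_{t-j}$, $e_{t-j}$, $\sigma_{t+1}^2$ and
   $(e_t^2, \dots, e_{t-q+1}^2)$. *)
Definition ulag x (j : nat) : R := x`_j - \sum_(k < p.-1) ar k * x`_(j + k.+1).

Definition elag x j : R := ulag x j - g (ulag x j.+1).

Definition vol x : R := zeta ord0 x * omega +
  \sum_(i < q) alpha i * zeta (lift ord0 i) x * elag x i ^+ 2.

Definition evec x : 'cV[R]_q := \col_i elag x i ^+ 2.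

Lemma path_ofN x (j : nat) : path_of x (- j%:Z) = x`_j.
Proof. by rewrite /path_of abszN absz_nat. Qed.

Lemma u_path_ofN x (j : nat) : u_ ar (path_of x) (- j%:Z) = ulag x j.
Proof.
rewrite /u_ path_ofN /ulag; congr (_ - _); apply: eq_bigr => k _.
by rewrite -opprD -PoszD path_ofN.
Qed.

Lemma rhs_path_of x z : rhs ar g omega alpha zeta (path_of x) 1 z =
  \sum_(k < p.-1) ar k * x`_k + g (ulag x 0) + Num.sqrt (vol x) * z.
Proof.
have S1 j : (1 - j.+1%:Z) = - j%:Z :> int.
  by rewrite -addn1 PoszD opprD addrCA subrr addr0.
have S3 j : - j%:Z - 1 = - j.+1%:Z by rewrite -addn1 PoszD opprD.
have S5 : (1 - 1 : int) = - 0%:Z by rewrite subrr.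
rewrite /rhs /sigma2 /e_ S5 u_path_ofN oppr0 state_path_of.
congr (_ + _ + Num.sqrt (_ + _) * _).
  by apply: eq_bigr => k _; rewrite S1 path_ofN.
by apply: eq_bigr => k _; rewrite S1 S3 !u_path_ofN.
Qed.

Lemma nth_next0 x z : (next x z)`_0 =
  \sum_(k < p.-1) ar k * x`_k + g (ulag x 0) + Num.sqrt (vol x) * z.
Proof.
have pq : (0 < p + q)%N by rewrite addn_gt0 hp.
by rewrite -(tnth_nth 0 _ (Ordinal pq)) tnth_mktuple/= rhs_path_of.
Qed.

Lemma nth_nextS x z j : (j.+1 < p + q)%N -> (next x z)`_j.+1 = x`_j.
Proof.
by move=> jpq; rewrite -(tnth_nth 0 _ (Ordinal jpq)) tnth_mktuple.
Qed.

Lemma ulag_next0 x z : ulag (next x z) 0 = g (ulag x 0) + Num.sqrt (vol x) * z.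
Proof.
rewrite {1}/ulag nth_next0.
rewrite [X in _ - X](_ : _ = \sum_(k < p.-1) ar k * x`_k); first by ring.
apply: eq_bigr => k _; rewrite add0n nth_nextS//.
by rewrite (leq_trans _ (leq_addr _ _))// -ltn_predRL.
Qed.

(** At lag [j.+1], [ulag] reads coordinates up to [j + p], which stay inside the state exactly when
    [j < q]. *)
Lemma ulag_nextS x z j : (j < q)%N -> ulag (next x z) j.+1 = ulag x j.
Proof.
move=> jq; have b k : (k < p)%N -> (j.+1 + k < p + q)%N.
  by move=> kp; rewrite addnC -addSn leq_add.
rewrite /ulag nth_nextS ?(leq_trans _ (b 0%N _))// ?addn0//.
congr (_ - _); apply: eq_bigr => k _; rewrite addSn nth_nextS// -addSn b//.
by rewrite -ltn_predRL.
Qed.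

Lemma elag_next0 x z : elag (next x z) 0 = Num.sqrt (vol x) * z.
Proof. by rewrite /elag ulag_next0 ulag_nextS// addrAC subrr add0r. Qed.

Lemma elag_nextS x z j : (j.+1 < q)%N -> elag (next x z) j.+1 = elag x j.
Proof. by move=> jq; rewrite /elag !ulag_nextS// ltnW. Qed.

Hypotheses (homega : 0 < omega) (halpha : forall i, 0 <= alpha i)
  (zeta_range : forall i x, 0 < zeta i x <= 1).

Lemma vol_ge0 x : 0 <= vol x.
Proof.
have z0 i : 0 <= zeta i x by case/andP: (zeta_range i x) => /ltW.
rewrite addr_ge0// ?mulr_ge0 ?(ltW homega)//.
by apply: sumr_ge0 => i _; rewrite mulr_ge0 ?sqr_ge0// mulr_ge0.
Qed.

Lemma vol_le x : vol x <= omega + \sum_i alpha i * evec x i 0.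
Proof.
have z1 i : zeta i x <= 1 by case/andP: (zeta_range i x).
rewrite lerD//; first by rewrite ler_piMl ?(ltW homega).
by apply: ler_sum => i _; rewrite mxE ler_wpM2r ?sqr_ge0// ler_piMr.
Qed.

(** The first coordinate is [vol x * z^2], bounded through [vol_le]; the others are shifted by the
    subdiagonal ones of [Lambda]. The entrywise absolute values are the form that a monotone norm
    takes as input. *)
Lemma evec_next_le x z i :
  `|evec (next x z) i 0| <= `|(Lambda alpha z *m evec x +
     (omega * z ^+ 2) *: delta_mx (Ordinal hq) 0) i 0|.
Proof.
have D j : (delta_mx (Ordinal hq) 0 : 'cV[R]_q) j 0 = if j == 0 :> nat then 1 else 0.
  by rewrite mxE eqxx andbT -val_eqE /=; case: (_ == _).
rewrite [X in _ <= `|X|]mxE [X in _ <= `|X + _|]mxE.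
rewrite [X in _ <= `|_ + X|]mxE D [X in `|X|]mxE.
case: i => -[|j] jq /=.
  rewrite mulr1 elag_next0 exprMn sqr_sqrtr ?vol_ge0//.
  rewrite (eq_bigr (fun i => alpha i * evec x i 0 * z ^+ 2)); last first.
    by move=> i _; rewrite !mxE/= mulrAC.
  have v0 : 0 <= \sum_i alpha i * evec x i 0.
    by rewrite sumr_ge0// => k _; rewrite mulr_ge0// mxE sqr_ge0.
  rewrite -mulr_suml -mulrDl normrM [leRHS]normrM ler_wpM2r//.
  by rewrite !ger0_norm ?vol_ge0 1?addrC ?vol_le// addr_ge0// ltW.
rewrite mulr0 addr0 elag_nextS// (bigD1 (Ordinal (ltnW jq)))//=.
rewrite big1 => [|k kj]; first by rewrite !mxE/= eqxx mul1r addr0.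
rewrite mxE/= eqSS (negbTE (_ : j != k :> nat)) ?mul0r//.
by apply: contraNneq kj => jk; apply/eqP/val_inj.
Qed.

End model_algebra.

(** * Measurability of the transition map *)

Section model_measurability.
Context {R : realType} (p q : nat).
Variables (ar : 'I_p.-1 -> R) (g : R -> R) (omega : R) (alpha : 'I_q -> R)
  (zeta : 'I_q.+1 -> (p + q).-tuple R -> R).
Hypotheses (g_meas : measurable_fun setT g)
  (zeta_meas : forall i, measurable_fun setT (zeta i)).

Lemma measurable_nth (n j : nat) :
  measurable_fun setT (fun x : n.-tuple R => x`_j).
Proof.
have [jn|nj] := ltnP j n.
  rewrite (_ : (fun x => _) = @tnth n R ^~ (Ordinal jn)).
    exact: measurable_tnth.
  by apply/funext => x; rewrite (tnth_nth 0).
rewrite (_ : (fun x => _) = cst 0)//.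
by apply/funext => x; rewrite nth_default// size_tuple.
Qed.

Lemma measurable_ulag j : measurable_fun setT (fun x : (p + q).-tuple R => ulag ar x j).
Proof.
apply: measurable_funB; first exact: measurable_nth.
by apply: measurable_sum => k; apply: measurable_funM => //; exact: measurable_nth.
Qed.

Lemma measurable_elag j : measurable_fun setT (fun x : (p + q).-tuple R => elag ar g x j).
Proof.
apply: measurable_funB; first exact: measurable_ulag.
by apply: measurableT_comp => //; exact: measurable_ulag.
Qed.

Lemma measurable_vol : measurable_fun setT (vol ar g omega alpha zeta).
Proof.
apply: measurable_funD; first exact: measurable_funM.
apply: measurable_sum => i; apply: measurable_funM; first exact: measurable_funM.
by apply: measurable_funX; exact: measurable_elag.
Qed.

Lemma measurable_next_state (hp : (1 <= p)%N) d (T : measurableType d) (X : T -> R) :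
  measurable_fun setT X -> measurable_fun setT
    (fun a : (p + q).-tuple R * T => next_state ar g omega alpha zeta a.1 (X a.2)).
Proof.
move=> mX; apply/measurable_fun_tnthP => i.
have m1 (f : (p + q).-tuple R -> R) : measurable_fun setT f ->
    measurable_fun setT (fun a : (p + q).-tuple R * T => f a.1).
  by move=> mf; exact: measurableT_comp.
case: i => -[|j] jpq.
  rewrite (_ : _ \o _ = fun a : (p + q).-tuple R * T =>
    \sum_(k < p.-1) ar k * a.1`_k + g (ulag ar a.1 0) +
    Num.sqrt (vol ar g omega alpha zeta a.1) * X a.2); last first.
    by apply/funext => a; rewrite /= (tnth_nth 0) nth_next0.
  apply: measurable_funD; first apply: measurable_funD.
  - apply: measurable_sum => k; apply: measurable_funM => //.
    by apply: (m1 (fun x => x`_k)); exact: measurable_nth.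
  - apply: measurableT_comp => //.
    by apply: (m1 (fun x => ulag ar x 0)); exact: measurable_ulag.
  - apply: measurable_funM; last exact: measurableT_comp.
    apply: (measurableT_comp (f := @Num.sqrt R)).
      by apply: continuous_measurable_fun; exact: sqrt_continuous.
    by apply: (m1 (vol ar g omega alpha zeta)); exact: measurable_vol.
rewrite (_ : _ \o _ = fun a : (p + q).-tuple R * T => a.1`_j).
  by apply: (m1 (fun x => x`_j)); exact: measurable_nth.
by apply/funext => a; rewrite /= (tnth_nth 0) nth_nextS.
Qed.

End model_measurability.

(** * Stationary moments of the volatility and of [u] *)

Section stationary_moments.
Context {R : realType} (p q : nat).
Variables (ar : 'I_p.-1 -> R) (g : R -> R) (omega : R) (alpha : 'I_q -> R)
  (zeta : 'I_q.+1 -> (p + q).-tuple R -> R).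
Hypotheses (hp : (1 <= p)%N) (hq : (1 <= q)%N).
Hypotheses (g_meas : measurable_fun setT g)
  (zeta_meas : forall i, measurable_fun setT (zeta i)).
Hypotheses (homega : 0 < omega) (halpha : forall i, 0 <= alpha i)
  (zeta_range : forall i x, 0 < zeta i x <= 1).
Context d (T : measurableType d) (P : probability T R) (X : {RV P >-> R}).
Context (pi : probability ((p + q).-tuple R) R).

Local Notation next := (next_state ar g omega alpha zeta).

Hypothesis pi_stationary : stationary (fun x A => P [set w | A (next x (X w))]) pi.

Lemma model_drift (V f : (p + q).-tuple R -> R) (h : (p + q).-tuple R -> \bar R) :
  measurable_fun setT V -> measurable_fun setT f -> measurable_fun setT h ->
  (forall x, 0 <= V x)%R -> (forall x, 0 <= f x)%R -> (forall x, 0 <= h x)%E ->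
  (forall x, \int[P]_w (V (next x (X w)))%:E + (f x)%:E <= (V x)%:E + h x)%E ->
  (\int[pi]_x (f x)%:E <= \int[pi]_x h x)%E.
Proof.
have mX : measurable_fun setT X by [].
exact: (stationary_drift
  (measurable_next_state ar omega alpha g_meas zeta_meas hp mX)).
Qed.

Lemma measurable_next (V : (p + q).-tuple R -> R) x : measurable_fun setT V ->
  measurable_fun setT (fun w => V (next x (X w))).
Proof.
move=> mV; have mX : measurable_fun setT X by [].
have mn := measurable_next_state ar omega alpha g_meas zeta_meas hp mX.
exact: (measurableT_comp (measurableT_comp mV mn) (pair1_measurable x)).
Qed.

Context (N : 'cV[R]_q -> R) (HN : monotone_norm N) (e : R).
Hypothesis e0 : 0 < e.

(** The Lyapunov function of the ARCH part; being built on squares, it has order [2 * e] in the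
    residuals. *)
Definition archV (x : (p + q).-tuple R) : R := N (evec ar g x) `^ e.

Lemma measurable_archV : measurable_fun setT archV.
Proof.
apply: (measurableT_comp (measurable_powR _)).
apply: (measurable_norm_mono HN (f := fun i x => elag ar g x i ^+ 2)) => i.
by apply: measurable_funX; exact: measurable_elag.
Qed.

Hypothesis X_moment : (\int[P]_w ((X w ^+ 2) `^ e)%:E < +oo)%E.

Lemma arch_moment lam : 0 <= lam < 1 ->
  (forall v, (\int[P]_w (N (Lambda alpha (X w) *m v) `^ e)%:E <= (lam * N v `^ e)%:E)%E) ->
  (\int[pi]_x (archV x)%:E < +oo)%E.
Proof.
move=> /andP[lam0 lam1] Hlam; have mX : measurable_fun setT X by [].
(* A factor above 1 with [mu * lam < 1], written so as to cover [lam = 0]. *)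
pose mu := 2 / (1 + lam).
have mu1 : 1 < mu by rewrite ltr_pdivlMr; lra.
have mu0 : 0 <= mu by rewrite ltW// (lt_trans _ mu1).
have mulam : mu * lam < 1 by rewrite /mu mulrAC ltr_pdivrMr; lra.
have [C C0 HC] := powRD_split e0 mu1.
pose nd := N (delta_mx (Ordinal hq) 0); have nd0 : 0 <= nd by exact: norm_mono_ge0.
pose k := C * (omega * nd) `^ e.
have k0 : 0 <= k by rewrite mulr_ge0 ?powR_ge0.
have X2e0 w : 0 <= (X w ^+ 2) `^ e by exact: powR_ge0.
pose M := fine (\int[P]_w ((X w ^+ 2) `^ e)%:E).
have IX0 : (0 <= \int[P]_w ((X w ^+ 2) `^ e)%:E)%E.
  by apply: integral_ge0 => w _; rewrite lee_fin.
have EM : (\int[P]_w ((X w ^+ 2) `^ e)%:E)%E = M%:E.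
  by rewrite fineK// ge0_fin_numE.
have M0 : 0 <= M by exact: fine_ge0.
have V0 x : 0 <= archV x by exact: powR_ge0.
have mV := measurable_archV.
have c0 : 0 < 1 - mu * lam by lra.
have drift x : (\int[P]_w (archV (next x (X w)))%:E + ((1 - mu * lam) * archV x)%:E <=
    (archV x)%:E + (k * M)%:E)%E.
  have mL : measurable_fun setT (fun w => N (Lambda alpha (X w) *m evec ar g x) `^ e).
    apply: (measurableT_comp (measurable_powR _)).
    exact: measurable_norm_Lambda.
  have mX2 : measurable_fun setT (fun w => (X w ^+ 2) `^ e).
    by apply: (measurableT_comp (measurable_powR _)); exact: measurable_funX.
  have le1 : (\int[P]_w (archV (next x (X w)))%:E <=
     \int[P]_w (mu * N (Lambda alpha (X w) *m evec ar g x) `^ e +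
       k * (X w ^+ 2) `^ e)%:E)%E.
    apply: ge0_le_integral => //.
    - by move=> w _; rewrite lee_fin.
    - by apply/measurable_EFinP; exact: measurable_next.
    - by apply/measurable_EFinP; apply: measurable_funD; exact: measurable_funM.
    - move=> w _; rewrite lee_fin.
      apply: (@le_trans _ _ ((N (Lambda alpha (X w) *m evec ar g x) +
         omega * nd * X w ^+ 2) `^ e)).
        apply: ge0_ler_powR; rewrite ?nnegrE ?norm_mono_ge0 ?(ltW e0)//.
          by rewrite addr_ge0 ?norm_mono_ge0// mulr_ge0 ?sqr_ge0// mulr_ge0// ltW.
        apply: le_trans (norm_mono HN (evec_next_le ar g hp hq homega halpha zeta_range _ _)) _.
        apply: le_trans (normD_mono HN _ _) _.
        rewrite lerD2l normZ_mono// ger0_norm; first by rewrite mulrAC.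
        exact: mulr_ge0 (ltW homega) (sqr_ge0 _).
      apply: le_trans (HC _ _ (norm_mono_ge0 HN _) _) _.
        by rewrite mulr_ge0 ?sqr_ge0// mulr_ge0// ltW.
      by rewrite powRM ?sqr_ge0 ?mulr_ge0 ?(ltW homega)// mulrA.
  apply: le_trans (leeD2r _ le1) _.
  rewrite (ge0_integral_comb P mL mX2 (fun w => powR_ge0 _ _) (fun w => powR_ge0 _ _) mu0 k0) EM.
  have le2 := lee_wpmul2l (_ : (0 <= mu%:E)%E) (Hlam (evec ar g x)).
  apply: le_trans (leeD2r _ (leeD2r _ (le2 _))) _; first by rewrite lee_fin.
  rewrite -!EFinM -!EFinD lee_fin /archV.
  by rewrite le_eqVlt; apply/orP; left; apply/eqP; ring.
have := model_drift mV (f := fun x => (1 - mu * lam) * archV x)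
  (h := fun=> (k * M)%:E) (measurable_funM (measurable_cst _) mV) (measurable_cst _) V0
  (fun x => mulr_ge0 (ltW c0) (V0 x)).
move=> /(_ _ drift) bnd.
have fin : (\int[pi]_x ((1 - mu * lam) * archV x)%:E < +oo)%E.
  apply: le_lt_trans (bnd _) _ => [x|]; first by rewrite lee_fin mulr_ge0.
  by rewrite integral_cst//= probability_setT mule1 ltry.
apply: ge0_integral_le_affine_lty (0) ((1 - mu * lam)^-1) _ _ _ _ _ _ _ fin => //.
- exact: measurable_funM.
- by move=> x; rewrite mulr_ge0// ltW.
- by rewrite invr_ge0 ltW.
- by move=> x; rewrite add0r mulKf// gt_eqF.
Qed.

Hypotheses (X_mean : ('E_P[X] = 0)%E) (X_var : ('V_P[X] = 1)%E).

(** By monotonicity each coordinate of a vector is at most its norm divided by the norm of the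
    coordinate vector, so the volatility is at most affine in the norm of [evec]. *)
Lemma vol_moment : (\int[pi]_x (archV x)%:E < +oo)%E ->
  (\int[pi]_x (vol ar g omega alpha zeta x `^ e)%:E < +oo)%E.
Proof.
move=> archoo.
have [C C0 HC] := powRD_split e0 (ltr1n R 2).
have nd0 := norm_mono_delta_gt0 HN.
pose A := \sum_i alpha i / N (delta_mx i 0).
have A0 : 0 <= A by apply: sumr_ge0 => i _; rewrite divr_ge0// ltW.
apply: ge0_integral_le_affine_lty (2 * omega `^ e) (C * A `^ e) _ _ _ _ _ _ _ archoo => //.
- exact: measurable_archV.
- by apply: (measurableT_comp (measurable_powR _)); exact: measurable_vol.
- by move=> x; exact: powR_ge0.
- by move=> x; exact: powR_ge0.
- by rewrite mulr_ge0 ?powR_ge0.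
- by rewrite mulr_ge0 ?powR_ge0.
move=> x; set v := evec ar g x.
have vN : vol ar g omega alpha zeta x <= omega + A * N v.
  apply: le_trans (vol_le ar g homega halpha zeta_range _) _; rewrite lerD2l /A mulr_suml.
  apply: ler_sum => i _; rewrite -mulrA ler_wpM2l// ler_pdivlMl//.
  have vi : 0 <= v i 0 by rewrite mxE sqr_ge0.
  rewrite mulrC -[X in X * _]ger0_norm// -normZ_mono//; apply: norm_mono => // j.
  rewrite !mxE eqxx andbT; have [->|ji] := eqVneq j i; last by rewrite mulr0 normr0.
  by rewrite mulr1.
apply: (@le_trans _ _ ((omega + A * N v) `^ e)).
  have N0 := norm_mono_ge0 HN v.
  apply: ge0_ler_powR; rewrite ?nnegrE ?(ltW e0)//; first exact: vol_ge0.
  by rewrite addr_ge0 ?(ltW homega)// mulr_ge0.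
apply: le_trans (HC _ _ (ltW homega) _) _; first by rewrite mulr_ge0// norm_mono_ge0.
by rewrite powRM ?norm_mono_ge0// mulrA.
Qed.

(** Once [integral_powR_normD] has integrated the innovation out, [subgeometric_drift] at
    [v = vol x] bounds the remainder by an affine function of the power [e] of the volatility, which
    is integrable. *)
Lemma ulag_moment r M0 K0 rho s :
  0 < r -> 0 < M0 -> 0 < K0 -> 0 < rho < 2 ->
  (forall u, M0 <= `|u| -> `|g u| <= (1 - r * `|u| `^ (- rho)) * `|u|) ->
  (forall u, `|u| <= M0 -> `|g u| <= K0) ->
  2 <= s -> (s - rho) / (2 - rho) <= e -> s / 2 <= e ->
  (\int[pi]_x (vol ar g omega alpha zeta x `^ e)%:E < +oo)%E ->
  (\int[pi]_x (`|ulag ar x 0| `^ (s - rho))%:E < +oo)%E.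
Proof.
move=> r0 M00 K00 hrho gl gs s2 se s2e voloo; have mX : measurable_fun setT X by [].
(* The innovation has a moment of order [2 * e], and [s <= 2 * e]. *)
have Xs : (\int[P]_w (`|X w| `^ s)%:E < +oo)%E.
  apply: ge0_integral_le_affine_lty (1) (1) _ _ _ _ _ _ _ X_moment => //.
  - by apply: (measurableT_comp (measurable_powR _)); exact: measurable_funX.
  - by apply: (measurableT_comp (measurable_powR _)); exact: measurableT_comp.
  - by move=> w; exact: powR_ge0.
  move=> w; rewrite mul1r.
  have -> : `|X w| `^ s = (X w ^+ 2) `^ (s / 2).
    rewrite -(real_normK (num_real (X w))) -powR_mulrn// -powRrM.
    by congr (_ `^ _); field.
  by rewrite powR_le1D ?sqr_ge0//; apply/andP; split => //; lra.
have [C C0 HC] := integral_powR_normD X_mean X_var s2 Xs.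
have [D D0 HD] := subgeometric_drift r0 M00 K00 hrho gl gs s2 se s2e C0.
have mu : measurable_fun setT (fun x : (p + q).-tuple R => ulag ar x 0).
  exact: measurable_ulag.
have mup k : measurable_fun setT (fun x : (p + q).-tuple R => `|ulag ar x 0| `^ k).
  by apply: (measurableT_comp (measurable_powR _)); exact: measurableT_comp.
have mv : measurable_fun setT (fun x => vol ar g omega alpha zeta x `^ e).
  by apply: (measurableT_comp (measurable_powR _)); exact: measurable_vol.
pose h x := D + D * vol ar g omega alpha zeta x `^ e.
have h0 x : 0 <= h x by rewrite addr_ge0// mulr_ge0 ?powR_ge0.
have mh : measurable_fun setT h.
  by apply: measurable_funD => //; exact: measurable_funM.
have hoo : (\int[pi]_x (h x)%:E < +oo)%E.
  apply: (ge0_integral_le_affine_lty (k := D) (l := D) mv mh _ h0 D0 D0 _ voloo) => //.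
  by move=> x; exact: powR_ge0.
have r2 : 0 < r / 2 by lra.
(* The power [s] of [|u|] serves as Lyapunov function without being known to be integrable; only the
   order [s - rho] is gained. *)
have foo : (\int[pi]_x (r / 2 * `|ulag ar x 0| `^ (s - rho))%:E < +oo)%E.
  apply: le_lt_trans hoo.
  apply: (model_drift (V := fun x => `|ulag ar x 0| `^ s)) => //.
  - exact: measurable_funM.
  - exact/measurable_EFinP.
  - by move=> x; rewrite mulr_ge0 ?powR_ge0// ltW.
  move=> x; have v0 := vol_ge0 ar g homega halpha zeta_range x.
  under eq_integral do rewrite ulag_next0//.
  have le1 := HC (g (ulag ar x 0)) _ (sqrtr_ge0 (vol ar g omega alpha zeta x)).
  apply: le_trans (leeD2r _ le1) _; rewrite -!EFinD lee_fin.
  rewrite sqr_sqrtr//; have -> : Num.sqrt (vol ar g omega alpha zeta x) `^ s =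
      vol ar g omega alpha zeta x `^ (s / 2).
    by rewrite -powR12_sqrt// -powRrM; congr (_ `^ _); field.
  by apply: le_trans (HD _ _ v0) _; rewrite /h mulrDr mulr1.
apply: ge0_integral_le_affine_lty (0) ((r / 2)^-1) _ _ _ _ _ _ _ foo => //.
- exact: measurable_funM.
- by move=> x; rewrite mulr_ge0 ?powR_ge0// ltW.
- by rewrite invr_ge0 ltW.
- by move=> x; rewrite add0r mulKf// gt_eqF.
Qed.

End stationary_moments.

(** * The complex modulus with real values *)

Section complex_modulus.
Context {R : rcfType}.
Implicit Types z : R[i].

(** The norm on [R[i]] takes its values in [R[i]]; real powers and integrals call for an element of
    [R]. *)
Definition modc z : R := complex.Re `|z|.

Lemma modcE z : `|z| = (modc z)%:C%C.
Proof. by rewrite /modc normc_def. Qed.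

Lemma modc_ge0 z : 0 <= modc z.
Proof. by rewrite -ler0c -modcE. Qed.

Lemma modcM z1 z2 : modc (z1 * z2) = modc z1 * modc z2.
Proof. by apply: complexI; rewrite rmorphM/= -!modcE normrM. Qed.

Lemma modcB z1 z2 : modc (z1 - z2) <= modc z1 + modc z2.
Proof. by rewrite -lecR rmorphD/= -!modcE ler_normB. Qed.

Lemma modc_gt0 z : z != 0 -> 0 < modc z.
Proof. by rewrite -ltcR -modcE normr_gt0. Qed.

Lemma modc_real (x : R) : modc x%:C%C = `|x|.
Proof. by rewrite /modc normc_def /= expr0n addr0 sqrtr_sqr. Qed.

Lemma modc_sqrt z : modc z = Num.sqrt (complex.Re z ^+ 2 + complex.Im z ^+ 2).
Proof. by rewrite /modc normc_def. Qed.

End complex_modulus.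

(** * Lag polynomials with complex coefficients *)

Section linear_filter.
Context {R : realType} (n : nat).
Implicit Types (c : {poly R[i]}) (x y : n.-tuple R).

(* The polynomial [c] in the lag operator applied to the path with past [x]. *)
Definition lagpoly c x : R[i] := \sum_(k < n) c`_k * (x`_k)%:C%C.

(** The real and imaginary parts are real linear combinations of the coordinates; [mk] treats both
    at once. *)
Lemma measurable_lagpoly c : measurable_fun setT (fun x => modc (lagpoly c x)).
Proof.
have mk (f : R[i] -> R) (fD : {morph f : a b / a + b >-> a + b}) (f0 : f 0 = 0)
    (fZ : forall a (b : R), f (a * b%:C%C) = f a * b) :
    measurable_fun setT (fun x => f (lagpoly c x)).
  rewrite (_ : (fun x => _) = fun x => \sum_(k < n) f c`_k * x`_k).
    apply: measurable_sum => k; apply: measurable_funM => //.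
    exact: measurable_nth.
  apply/funext => x; rewrite /lagpoly (big_morph _ fD f0).
  by apply: eq_bigr => k _; rewrite fZ.
under eq_fun do rewrite modc_sqrt.
apply: (measurableT_comp (f := @Num.sqrt R)).
  by apply: continuous_measurable_fun; exact: sqrt_continuous.
by apply: measurable_funD; apply: measurable_funX; apply: mk;
  [case=> ? ? []| |case=> ? ? ?; rewrite /= mulr0 ?subr0 ?add0r
  |case=> ? ? []| |case=> ? ? ?; rewrite /= mulr0 ?subr0 ?add0r].
Qed.

End linear_filter.

(** The factor ['X] delays by one step, and [y] delayed is [x]. The size bound ensures that no
    coefficient of [c * 'X] falls beyond the [n] stored values. *)
Lemma lagpoly_mulXsubC {R : realType} n (c : {poly R[i]}) z (x y : n.-tuple R) :
  (forall k, (k.+1 < n)%N -> y`_k.+1 = x`_k) ->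
  (size c < n)%N -> lagpoly (c * ('X - z%:P)) y = lagpoly c x - z * lagpoly c y.
Proof.
case: n x y => [//|m] x y yx cm.
rewrite /lagpoly mulr_sumr.
have -> : \sum_(k < m.+1) c`_k * (x`_k)%:C%C = \sum_(k < m.+1) (c * 'X)`_k * (y`_k)%:C%C.
  rewrite [RHS]big_ord_recl coefMX/= mul0r add0r big_ord_recr/=.
  rewrite [c`_m]nth_default// mul0r addr0.
  by apply: eq_bigr => k _; rewrite coefMX/= yx// ltnS.
rewrite -sumrB; apply: eq_bigr => k _.
by rewrite mulrBr coefB coefMC mulrBl mulrA [z * _]mulrC.
Qed.

Lemma lagpolyC {R : realType} n (a : R[i]) (x : n.-tuple R) : (0 < n)%N ->
  lagpoly a%:P x = a * (x`_0)%:C%C.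
Proof.
move=> n0; rewrite /lagpoly (bigD1 (Ordinal n0))//= coefC eqxx big1 ?addr0// => k k0.
have {}k0 : (k : nat) != 0%N by apply: contraNneq k0 => k0; apply/eqP/val_inj.
by rewrite coefC (negbTE k0) mul0r.
Qed.

Lemma size_ar_poly {R : realType} p (ar : 'I_p.-1 -> R) : (size (ar_poly ar) <= p.-1.+1)%N.
Proof.
rewrite /ar_poly (leq_trans (size_polyD _ _))// size_poly1 geq_max/= size_polyN.
apply: (leq_trans (size_sum _ _ _)); apply/bigmax_leqP => k _.
by rewrite (leq_trans (size_scale_leq _ _))// size_polyXn ltnS.
Qed.

Lemma ar_poly0 {R : realType} p (ar : 'I_p.-1 -> R) : (ar_poly ar)`_0 = 1.
Proof.
rewrite /ar_poly coefB coef1 coef_sum big1 ?subr0// => k _.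
by rewrite coefZ coefXn mulr0.
Qed.

Lemma lagpoly_ar {R : realType} p q (hp : (1 <= p)%N) (ar : 'I_p.-1 -> R)
    (x : (p + q).-tuple R) :
  lagpoly (map_poly (real_complex R) (ar_poly ar)) x = (ulag ar x 0)%:C%C.
Proof.
have pq : (0 < p + q)%N by rewrite addn_gt0 hp.
rewrite /lagpoly (eq_bigr (fun k : 'I_(p + q) => ((ar_poly ar)`_k * x`_k)%:C%C)); last first.
  by move=> k _; rewrite coef_map/= -rmorphM.
rewrite -rmorph_sum; congr (_%:C%C).
rewrite (eq_bigr (fun k : 'I_(p + q) => (k == 0 :> nat)%:R * x`_k -
    \sum_(j < p.-1) ar j * ((k == j.+1 :> nat)%:R * x`_k))); last first.
  move=> k _; rewrite /ar_poly coefB coef1 coef_sum mulrBl mulr_suml.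
  by congr (_ - _); apply: eq_bigr => j _; rewrite coefZ coefXn mulrA.
rewrite sumrB /ulag; congr (_ - _).
  rewrite (bigD1 (Ordinal pq))//= mul1r big1 ?addr0// => k k0.
  have {}k0 : (k : nat) != 0%N by apply: contraNneq k0 => k0; apply/eqP/val_inj.
  by rewrite (negbTE k0) mul0r.
rewrite exchange_big; apply: eq_bigr => j _; rewrite -mulr_sumr; congr (_ * _).
have jpq : (j.+1 < p + q)%N.
  by rewrite (leq_trans _ (leq_addr _ _))// -ltn_predRL.
rewrite (bigD1 (Ordinal jpq))//= eqxx mul1r big1 ?addr0// => k kj.
have {}kj : (k : nat) != j.+1 by apply: contraNneq kj => kj; apply/eqP/val_inj.
by rewrite (negbTE kj) mul0r.
Qed.

(** * Inversion of the autoregressive filter under stationarity *)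

Section stationary_filter.
Context {R : realType} (p q : nat).
Variables (ar : 'I_p.-1 -> R) (g : R -> R) (omega : R) (alpha : 'I_q -> R)
  (zeta : 'I_q.+1 -> (p + q).-tuple R -> R).
Hypotheses (hp : (1 <= p)%N).
Hypotheses (g_meas : measurable_fun setT g)
  (zeta_meas : forall i, measurable_fun setT (zeta i)).
Context d (T : measurableType d) (P : probability T R) (X : {RV P >-> R}).
Context (pi : probability ((p + q).-tuple R) R).

Local Notation next := (next_state ar g omega alpha zeta).

Hypothesis pi_stationary : stationary (fun x A => P [set w | A (next x (X w))]) pi.

Let F (a : (p + q).-tuple R * T) := next a.1 (X a.2).

Let mF : measurable_fun setT F.
Proof. by apply: measurable_next_state. Qed.

Lemma stationary_integral_next (V : (p + q).-tuple R -> R) :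
  measurable_fun setT V -> (forall x, 0 <= V x) ->
  (\int[pi]_x (V x)%:E = \int[pi]_x \int[P]_w (V (next x (X w)))%:E)%E.
Proof.
move=> mV V0; apply: (stationary_integral mF pi_stationary).
  exact/measurable_EFinP.
by move=> x; rewrite lee_fin.
Qed.

(** Coordinate [j.+1] of the next state is coordinate [j] of the present one, and both states have
    law [pi]. *)
Lemma shift_moment k j : (j.+1 < p + q)%N ->
  (\int[pi]_x (`|x`_j| `^ k)%:E < +oo)%E ->
  (\int[pi]_x (`|x`_j.+1| `^ k)%:E < +oo)%E.
Proof.
move=> jpq; apply: le_lt_trans.
rewrite (stationary_integral_next (V := fun x => `|x`_j.+1| `^ k)); last 2 first.
- apply: (measurableT_comp (measurable_powR _)).
  by apply: measurableT_comp => //; exact: measurable_nth.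
- by move=> x; exact: powR_ge0.
rewrite le_eqVlt; apply/orP; left; apply/eqP; apply: eq_integral => x _.
under eq_integral do rewrite nth_nextS//.
by rewrite (integral_cst P measurableT (`|x`_j| `^ k)%:E)/=; rewrite probability_setT mule1.
Qed.

Context (k : R).
Hypothesis k0 : 0 < k.

Let mV c : measurable_fun setT (fun x : (p + q).-tuple R => modc (lagpoly c x) `^ k).
Proof. by apply: (measurableT_comp (measurable_powR _)); exact: measurable_lagpoly. Qed.

(* Writing [w'] and [w] for the values of [c(L) y] at two consecutive times,
   [z w' = w - u'] with [u = (c ('X - z))(L) y]: a contraction since [|z| > 1]. *)
Lemma lagpoly_moment_step (c : {poly R[i]}) (z : R[i]) :
  1 < modc z -> (size c < p + q)%N ->
  (\int[pi]_x (modc (lagpoly (c * ('X - z%:P)) x) `^ k)%:E < +oo)%E ->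
  (\int[pi]_x (modc (lagpoly c x) `^ k)%:E < +oo)%E.
Proof.
move=> z1 cpq; set U := fun x : (p + q).-tuple R => modc (lagpoly (c * ('X - z%:P)) x) `^ k.
set V := fun x : (p + q).-tuple R => modc (lagpoly c x) `^ k.
move=> Uoo; have z0 : 0 < modc z by apply: lt_trans z1.
have U0 x : 0 <= U x by exact: powR_ge0.
have V0 x : 0 <= V x by exact: powR_ge0.
pose a := (modc z)^-1; have a0 : 0 < a by rewrite invr_gt0.
have a1 : a < 1 by rewrite invf_lt1.
pose lam := a `^ k; have lam0 : 0 <= lam by exact: powR_ge0.
have lam1 : lam < 1.
  have e1 : 1 = 1 `^ k by rewrite powR1.
  by rewrite [ltRHS]e1 gt0_ltr_powR// nnegrE// ltW.
(* As for the volatility: above 1, yet with [mu * lam < 1]. *)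
pose mu := 2 / (1 + lam).
have mu1 : 1 < mu by rewrite ltr_pdivlMr; lra.
have mu0 : 0 <= mu by rewrite ltW// (lt_trans _ mu1).
have mulam : mu * lam < 1 by rewrite /mu mulrAC ltr_pdivrMr; lra.
have [C C0 HC] := powRD_split k0 mu1.
have D0 : 0 <= C * lam by rewrite mulr_ge0.
have c0 : 0 < 1 - mu * lam by lra.
have step x w : V (next x (X w)) <= mu * lam * V x + C * lam * U (next x (X w)).
  set y := next x (X w).
  have yx j : (j.+1 < p + q)%N -> y`_j.+1 = x`_j by move=> jpq; exact: nth_nextS.
  have E : z * lagpoly c y = lagpoly c x - lagpoly (c * ('X - z%:P)) y.
    by rewrite (lagpoly_mulXsubC z yx cpq) opprB addrC subrK.
  have le1 : modc (lagpoly c y) <= a * modc (lagpoly c x) +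
      a * modc (lagpoly (c * ('X - z%:P)) y).
    rewrite -mulrDr /a ler_pdivlMl// -modcM E; exact: modcB.
  apply: (@le_trans _ _ ((a * modc (lagpoly c x) +
      a * modc (lagpoly (c * ('X - z%:P)) y)) `^ k)).
    apply: ge0_ler_powR; rewrite ?nnegrE ?(ltW k0) ?modc_ge0//.
    by rewrite addr_ge0// mulr_ge0 ?modc_ge0// ltW.
  apply: le_trans (HC _ _ _ _) _; rewrite ?mulr_ge0 ?modc_ge0 ?(ltW a0)//.
  by rewrite !powRM ?modc_ge0 ?(ltW a0)// !mulrA.
have mUF x : measurable_fun setT (fun w => U (next x (X w))).
  exact: (measurable_next ar omega alpha hp g_meas zeta_meas X x (mV _)).
have mVF x : measurable_fun setT (fun w => V (next x (X w))).
  exact: (measurable_next ar omega alpha hp g_meas zeta_meas X x (mV _)).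
(* The perturbation is evaluated at the next state, so the remainder is a conditional expectation;
   invariance turns its integral back into that of [U]. *)
pose h x := ((C * lam)%:E * \int[P]_w (U (next x (X w)))%:E)%E.
have IU0 x : (0 <= \int[P]_w (U (next x (X w)))%:E)%E.
  by apply: integral_ge0 => w _; rewrite lee_fin.
have mIU : measurable_fun setT (fun x => \int[P]_w (U (next x (X w)))%:E)%E.
  apply: (measurable_fun_fubini_tonelli_F (fun a => (U (F a))%:E)) => //.
    by apply/measurable_EFinP; apply: (measurableT_comp (mV _) mF).
  by move=> a'; rewrite lee_fin.
have mh : measurable_fun setT h by rewrite /h; apply: measurable_funeM.
have mf : measurable_fun setT (fun x => (1 - mu * lam) * V x).
  by apply: measurable_funM => //; exact: mV.
have foo : (\int[pi]_x ((1 - mu * lam) * V x)%:E < +oo)%E.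
  apply: (@le_lt_trans _ _ (\int[pi]_x h x)%E).
    apply: (model_drift hp g_meas zeta_meas pi_stationary (mV _) mf mh V0 (fun x => mulr_ge0 (ltW c0) (V0 x))) => //.
      by move=> x; rewrite mule_ge0.
    move=> x.
    apply: (@le_trans _ _ ((mu * lam * V x)%:E + h x + ((1 - mu * lam) * V x)%:E)%E).
      rewrite leeD2r// /h -(ge0_integral_affine _ (mUF x))//; last first.
        exact: mulr_ge0 (mulr_ge0 mu0 lam0) (V0 x).
      apply: ge0_le_integral => //.
      - by move=> w _; rewrite lee_fin powR_ge0.
      - exact/measurable_EFinP/mVF.
      - by apply/measurable_EFinP; apply: measurable_funD => //; exact: measurable_funM.
      - by move=> w _; rewrite lee_fin; exact: step.
    rewrite addeAC -EFinD; apply: leeD2r; rewrite lee_fin /V.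
    by rewrite le_eqVlt; apply/orP; left; apply/eqP; ring.
  rewrite /h ge0_integralZl_EFin// -(stationary_integral_next (V := U))//; last exact: mV.
  by rewrite lte_mul_pinfty// integral_ge0// => x _; rewrite lee_fin.
apply: (ge0_integral_le_affine_lty (k := 0) (l := (1 - mu * lam)^-1) mf (mV _)
  (fun x => mulr_ge0 (ltW c0) (V0 x)) V0 _ _ _ foo) => //.
  by rewrite invr_ge0 ltW.
by move=> x; rewrite add0r mulKf// gt_eqF.
Qed.

(** Factors are removed one at a time; [c] is general so that it can hold those still to be removed,
    and the size bound keeps every intermediate polynomial within the stored lags. *)
Lemma lagpoly_moment (s : seq R[i]) (c : {poly R[i]}) :
  (forall z, z \in s -> 1 < modc z) -> (size c + size s <= p + q)%N ->
  (\int[pi]_x (modc (lagpoly (c * \prod_(z <- s) ('X - z%:P)) x) `^ k)%:E < +oo)%E ->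
  (\int[pi]_x (modc (lagpoly c x) `^ k)%:E < +oo)%E.
Proof.
elim: s c => [|z s IHs] c s1 sz; first by rewrite big_nil mulr1.
rewrite big_cons mulrA => moo.
have zc : (size c < p + q)%N by rewrite (leq_trans _ sz)// addnS ltnS leq_addr.
apply: (lagpoly_moment_step (s1 z (mem_head _ _)) zc).
have s1' z' : z' \in s -> 1 < modc z' by move=> z's; apply: s1; rewrite in_cons z's orbT.
apply: (IHs (c * ('X - z%:P)) s1' _ moo).
apply: leq_trans sz; rewrite /= addnS -addSn leq_add2r.
by rewrite (leq_trans (size_polyMleq _ _))// size_XsubC addn2.
Qed.

(** Over the complex numbers the polynomial is its leading coefficient times linear factors. Once
    these are inverted, a nonzero multiple of the first coordinate is left. *)
Lemma ar_moment : (forall z : R[i],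
     root (map_poly (real_complex R) (ar_poly ar)) z -> 1 < `|z|) ->
  (\int[pi]_x (`|ulag ar x 0| `^ k)%:E < +oo)%E ->
  (\int[pi]_x (`|x`_0| `^ k)%:E < +oo)%E.
Proof.
set A := map_poly _ _ => roots uoo.
have pq : (0 < p + q)%N by rewrite addn_gt0 hp.
have [s sE] := closed_field_poly_normal A.
have A0 : A != 0.
  apply/eqP => /(congr1 (fun a : {poly R[i]} => a`_0)); rewrite coef_map ar_poly0 coef0.
  by move=> /(congr1 (@complex.Re R))/= /eqP; rewrite oner_eq0.
have lA : lead_coef A != 0 by rewrite lead_coef_eq0.
have moo : (\int[pi]_x (modc (lagpoly (lead_coef A)%:P x) `^ k)%:E < +oo)%E.
  apply: (@lagpoly_moment s).
  - move=> z zs; rewrite -ltcR -modcE; apply: roots; rewrite -/A sE rootZ//.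
    by rewrite root_prod_XsubC.
  (* The remaining constant has size 1, so the bound needed is [size A <= p + q], and
     [size A <= p]. *)
  - have : size A = (size s).+1 by rewrite sE size_scale// size_prod_XsubC.
    rewrite size_polyC lA add1n => <-; rewrite size_map_poly.
    by rewrite (leq_trans (size_ar_poly _))// prednK// leq_addr.
  - rewrite mul_polyC -sE; apply: le_lt_trans uoo; rewrite le_eqVlt; apply/orP; left.
    by apply/eqP; apply: eq_integral => x _; rewrite lagpoly_ar// modc_real.
have l0 : 0 < modc (lead_coef A) `^ k by rewrite powR_gt0// modc_gt0.
have mx : measurable_fun setT (fun x : (p + q).-tuple R => `|x`_0| `^ k).
  apply: (measurableT_comp (measurable_powR _)).
  by apply: measurableT_comp => //; exact: measurable_nth.
apply: (ge0_integral_le_affine_lty (k := 0) (l := (modc (lead_coef A) `^ k)^-1)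
  (mV _) mx (fun x => powR_ge0 _ _) (fun x => powR_ge0 _ _) _ _ _ moo) => //.
  by rewrite invr_ge0 ltW.
move=> x; rewrite add0r lagpolyC// modcM modc_real powRM ?modc_ge0//.
by rewrite mulKf// gt_eqF.
Qed.

Lemma coordinate_moment : (\int[pi]_x (`|x`_0| `^ k)%:E < +oo)%E ->
  forall i : 'I_(p + q), (\int[pi]_x (`|tnth x i| `^ k)%:E < +oo)%E.
Proof.
move=> x0 [j jpq]; under eq_integral do rewrite (tnth_nth 0)/=.
by elim: j jpq => [//|j IHj] jpq; apply: shift_moment => //; apply: IHj; exact: ltnW.
Qed.

End stationary_filter.

(** * Matching the exponents and assembling the moment bounds *)

Theorem mainTheorem2 (R : realType) (p q : nat)
  (hp : (1 <= p)%N) (hq : (1 <= q)%N)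
  (ar : 'I_p.-1 -> R) (g : R -> R) (omega : R) (alpha : 'I_q -> R)
  (zeta : 'I_q.+1 -> (p + q).-tuple R -> R)
  (d : measure_display) (T : measurableType d) (P : probability T R)
  (eps : nat -> {RV P >-> R}) (y : int -> {RV P >-> R})
  (model : forall (t : nat) (w : T),
     y t.+1%:Z w =
     rhs ar g omega alpha zeta (fun s => y s w) t.+1%:Z (eps t.+1 w))
  (eps_ident : identically_distributed P (fun t => eps t.+1))
  (eps_indep : mutually_independent P (fun t => eps t.+1))
  (eps_init : independent_of_seq P
     (fun w => state p q (fun s => y s w) 0) (fun t => eps t.+1))
  (eps_mean : ('E_P[eps 1%N] = 0)%E) (eps_var : ('V_P[eps 1%N] = 1)%E)
  (eps_density : exists2 f : R -> R,
     is_density P (eps 1%N) f & bounded_away_on_compacts f)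
  (ar_roots : forall z : R[i],
     root (map_poly (real_complex R) (ar_poly ar)) z -> 1 < `|z|)
  (g_meas : measurable_fun setT g) (g_loc : locally_bounded g)
  (g_pinfty : `|g u| @[u --> +oo] --> +oo)
  (g_ninfty : `|g u| @[u --> -oo] --> +oo)
  (r M0 K0 rho : R) (hr : 0 < r) (hM0 : 0 < M0) (hK0 : 0 < K0)
  (hrho : 0 < rho < 2)
  (g_large : forall u : R,
     M0 <= `|u| -> `|g u| <= (1 - r * `|u| `^ (- rho)) * `|u|)
  (g_small : forall u : R, `|u| <= M0 -> `|g u| <= K0)
  (homega : 0 < omega) (halpha : forall i, 0 <= alpha i)
  (halpha_sum : \sum_i alpha i < 1)
  (zeta_range : forall i x, 0 < zeta i x <= 1)
  (zeta_meas : forall i, measurable_fun setT (zeta i))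
  (s0 b : R) (hs0 : 1 <= s0) (hb : 1 <= b)
  (hb1 : s0 = 1 -> b = 1)
  (hb2 : 1 < s0 -> (2 * s0 - rho) / (s0 * (2 - rho)) < b)
  (Lambda_contract : exists2 N : 'cV[R]_q -> R, monotone_norm N &
     exists2 m : \bar R,
       is_max [set ('E_P[fun w => (N (Lambda alpha (eps 1%N w) *m x)
                                    `^ (b * s0))%R] `^ (b * s0)^-1)%E
              | x in [set x : 'cV[R]_q | N x = 1]] m
       & (m < 1)%E)
  (* If some $\alpha_i$ is nonzero this moment is finite by [Lambda_contract];
     if all vanish, [Lambda_contract] says nothing about the innovations. *)
  (eps_moment : (forall i, alpha i = 0) ->
     ('E_P[fun w => (`|eps 1%N w| `^ (2 * b * s0))%R] < +oo)%E)
  (pi : probability ((p + q).-tuple R) R)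
  (pi_stationary : stationary
     (fun x A => P [set w | A (next_state ar g omega alpha zeta x
                                 (eps 1%N w))]) pi) :
  forall i : 'I_(p + q),
    (\int[pi]_x (`|tnth x i| `^ (2 * s0 - rho))%:E < +oo)%E.
Proof.
have [s1 b1] := (lt_le_trans ltr01 hs0, lt_le_trans ltr01 hb).
have e0 : 0 < b * s0 by exact: mulr_gt0.
have /andP[rho0 rho2] := hrho.
case: Lambda_contract => N HN [m m_max m1].
(* A nonzero weight yields this moment from the contraction; when all weights vanish it is
   [eps_moment]. *)
have X_moment : (\int[P]_w ((eps 1%N w ^+ 2) `^ (b * s0))%:E < +oo)%E.
  have [j aj|a0] := pickP (fun j => alpha j != 0).
    exact: (Lambda_moment_finite HN e0 m_max m1 hq (halpha j) aj).
  have : (forall i, alpha i = 0) by move=> i; apply/eqP/negbFE/a0.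
  move=> /eps_moment; rewrite unlock; apply: le_lt_trans.
  rewrite le_eqVlt; apply/orP; left; apply/eqP; apply: eq_integral => w _.
  congr (_%:E); rewrite -(real_normK (num_real (eps 1%N w))) -powR_mulrn// -powRrM.
  by congr (_ `^ _); ring.
have [lam lam01 Hlam] := Lambda_moment_contract HN e0 m_max m1.
have archoo := arch_moment hp hq g_meas zeta_meas homega halpha zeta_range
  pi_stationary HN e0 X_moment lam01 Hlam.
have voloo := vol_moment g_meas zeta_meas homega halpha zeta_range HN e0 archoo.
have k0 : 0 < 2 * s0 - rho by lra.
(* The exponent that Young's inequality demands of the volatility. At [s0 = 1] both sides equal 1;
   for [s0 > 1] this is the lower bound on [b] multiplied by [s0]. *)
have Q : (2 * s0 - rho) / (2 - rho) <= b * s0.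
  have [s0_eq1|s0_neq1] := eqVneq s0 1.
    by rewrite (hb1 s0_eq1) s0_eq1 !mulr1 divff//; apply: lt0r_neq0; lra.
  have s0_gt1 : 1 < s0 by rewrite lt_neqAle eq_sym s0_neq1.
  have := ltW (hb2 s0_gt1); rewrite ler_pdivrMr; last by apply: mulr_gt0; lra.
  by rewrite ler_pdivrMr ?mulrA//; lra.
have s_half : 2 * s0 / 2 <= b * s0 by nra.
have uoo := ulag_moment hp g_meas zeta_meas homega halpha zeta_range pi_stationary
  X_moment eps_mean eps_var hr hM0 hK0 hrho g_large g_small
  (_ : 2 <= 2 * s0) Q s_half voloo.
apply: (coordinate_moment hp g_meas zeta_meas pi_stationary).
apply: (ar_moment hp g_meas zeta_meas pi_stationary k0 ar_roots).
by apply: uoo; lra.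
Qed.
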